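(* Let $A\in\mathscr{B}(\mathscr{H})$. Then for every $0\le t\le 1$, \[ \omega(A)\le \frac12\left(\|A\|+\sqrt{\left\||A|^{t}|A^*|^{t}\right\|\cdot\left\||A|^{1-t}|A^*|^{1-t}\right\|}\right). \]
   Context: $\mathscr{B}(\mathscr{H})$ is the $C^*$-algebra of all bounded linear operators on a complex Hilbert space $\mathscr{H}$ with inner product $\langle\cdot,\cdot\rangle$. For $T\in\mathscr{B}(\mathscr{H})$: $\omega(T)=\sup_{\|x\|=1}|\langle Tx,x\rangle|$ is the numerical radius; $\|T\|=\sup_{\|x\|=1}\|Tx\|$ is the operator norm; $T^*$ is the adjoint; $|T|=(T^*T)^{1/2}$. Real powers of positive operators are defined by the continuous functional calculus, with $T^0=I$. *)

(* Defs.v *)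
From HB Require Import structures.
From mathcomp Require Import all_boot all_order all_algebra.
From mathcomp Require Import complex sesquilinear.
From mathcomp Require Import all_classical all_reals all_analysis.

Set Implicit Arguments.
Unset Strict Implicit.
Unset Printing Implicit Defensive.

Import Order.TTheory GRing.Theory Num.Theory.
Import numFieldNormedType.Exports.

Local Open Scope classical_set_scope.
Local Open Scope ring_scope.
Local Open Scope complex_scope.

(* [inner] is linear in its first argument and conjugate-linear in its second. *)
HB.mixin Record CompleteNormedModule_isHilbert (R : realType) H
    of CompleteNormedModule R[i] H := {
  inner : {dot H for (@Num.conj R[i])} ;
  inner_norm : forall x : H, inner x x = `|x| ^+ 2
}.

#[short(type="hilbertType")]
HB.structure Definition Hilbert (R : realType) :=
  { H of CompleteNormedModule_isHilbert R H & CompleteNormedModule R[i] H }.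

(* Norms in a module over R[i], and moduli in R[i], are real elements of R[i];
   [rnorm] reads them in R. *)
Definition rnorm {R : realType} {V : normedZmodType R[i]} (x : V) : R :=
  complex.Re `|x|.

Section Operators.
Context {R : realType} {H : hilbertType R}.
Implicit Types (T S X : H -> H) (f : R[i] -> R[i]) (p : {poly R[i]}).

Definition bounded_operator : set (H -> H) :=
  [set T | linear T /\ exists M : R, forall x, rnorm (T x) <= M * rnorm x].

(* For a bounded operator the sets below are bounded above, so these are
   genuine suprema, except that both are 0 when H = {0}. *)
Definition opnorm T : R := sup [set rnorm (T x) | x in [set x | rnorm x = 1]].

Definition numerical_radius T : R :=
  sup [set rnorm (inner (T x) x) | x in [set x | rnorm x = 1]].

Definition adjoint T : H -> H :=
  get [set S | bounded_operator S /\
               forall x y, inner (T x) y = inner x (S y)].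

Definition spectrum T : set R[i] :=
  [set z | ~ exists S, [/\ bounded_operator S,
     forall x, S (T x - z *: x) = x & forall x, T (S x) - z *: S x = x]].

Definition poly_op p T : H -> H :=
  fun x => \sum_(i < size p) p`_i *: iter i T x.

(* X = f(T) in the continuous functional calculus of a self-adjoint T:
   X is the operator-norm limit of p_n(T) for polynomials p_n converging
   to f uniformly on the spectrum of T. *)
Definition is_cfc f T X : Prop :=
  bounded_operator X /\
  exists p : nat -> {poly R[i]},
    (forall e : R, 0 < e -> \forall n \near \oo,
       forall z, spectrum T z -> rnorm ((p n).[z] - f z) <= e) /\
    (opnorm (fun x => poly_op (p n) T x - X x) @[n --> \oo] --> (0 : R)).

Definition cfc f T : H -> H := get [set X | is_cfc f T X].

(* Meant for positive T, whose spectrum lies in [0, +oo[.  Since 0 `^ 0 = 1,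
   the exponent t = 0 gives the identity. *)
Definition opow T (t : R) : H -> H :=
  cfc (fun z => (complex.Re z `^ t)%:C) T.

Definition oabs T : H -> H := opow (adjoint T \o T) (2^-1).

End Operators.

(* Main.v *)
Require Import Defs.
From mathcomp Require Import all_boot all_order all_algebra.
From mathcomp Require Import complex sesquilinear.
From mathcomp Require Import all_classical all_reals all_analysis.
From mathcomp Require Import ring lra.

(** Write [P] and [Q] for the absolute values of [A] and of its adjoint. The proof
combines three inequalities.

The mixed Schwarz inequality [mixed_schwarz] bounds [|<A x, x>|] by the product of
the norms of [P^(1/2) x] and [Q^(1/2) x], hence by half the sum of their squares.

For a vector of norm 1, this sum of squares is at most the larger of the norms of [P]
and [Q] plus the norm of [P^(1/2) Q^(1/2)] ([sum_of_squares_le]). Both [P] and [Q]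
have norm at most that of [A], because [|P x| = |A x|] and similarly for [Q].

Finally, [opnorm_half_power_comp_le]: the square of the norm of [P^(1/2) Q^(1/2)] is
that of the self-adjoint [Q^(1/2) P Q^(1/2)], which is a spectral radius and therefore
does not change under cyclic permutation of factors. After splitting
[P = P^t P^(1 - t)] and [Q = Q^(1 - t) Q^t] and permuting, one gets a product of
[P^(1 - t) Q^(1 - t)] and [Q^t P^t]. The comparison of spectral radii,
[opnorm_comp_swap], only uses the growth of iterates.

Before this, the adjoint and the powers must be shown to exist and to obey
the rules of calculation. The source of existence is one variational lemma,
[coercive_riesz], a Riesz representation theorem for coercive operators. It gives
the adjoint, and it inverts coercive operators, which locates the spectrum of
self-adjoint and of positive operators. Since complex polynomials split, the spectrum
of [p(T)] is controlled by that of [T], and an approximate eigenvector argument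
shows that the norm of [p(T)] is at most the supremum of [|p|] on the spectrum
([opnorm_poly_op_le]). The functional calculus then is a completion argument, with
Bernstein polynomials approximating the powers [x `^ s] on bounded intervals. *)

Set Implicit Arguments.
Unset Strict Implicit.
Unset Printing Implicit Defensive.
Import Order.TTheory GRing.Theory Num.Theory.
Import numFieldNormedType.Exports.
Local Open Scope classical_set_scope.
Local Open Scope ring_scope.
Local Open Scope complex_scope.
Local Notation Re := complex.Re.

(** * Real-valued norms and the inner product *)

Section Rnorm.
Context {R : realType} {V : normedModType R[i]}.
Implicit Types (x y : V) (a : R[i]).

Lemma norm_rnorm (W : normedZmodType R[i]) (x : W) : `|x| = (rnorm x)%:C.
Proof. by rewrite /rnorm RRe_real ?normr_real. Qed.

Lemma rnorm_ge0 (W : normedZmodType R[i]) (x : W) : 0 <= rnorm x.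
Proof. by rewrite -lecR -norm_rnorm normr_ge0. Qed.

Lemma rnorm0_eq0 (W : normedZmodType R[i]) (x : W) : rnorm x = 0 -> x = 0.
Proof. by move=> h; apply/eqP; rewrite -normr_eq0 norm_rnorm h. Qed.

Lemma rnorm0 (W : normedZmodType R[i]) : rnorm (0 : W) = 0.
Proof. by rewrite /rnorm normr0. Qed.

Lemma rnormD (W : normedZmodType R[i]) (x y : W) : rnorm (x + y) <= rnorm x + rnorm y.
Proof. by rewrite -lecR rmorphD /= -!norm_rnorm ler_normD. Qed.

Lemma rnormN (W : normedZmodType R[i]) (x : W) : rnorm (- x) = rnorm x.
Proof. by rewrite /rnorm normrN. Qed.

Lemma rnormBC (W : normedZmodType R[i]) (x y : W) : rnorm (x - y) = rnorm (y - x).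
Proof. by rewrite -rnormN opprB. Qed.

Lemma rnormZ a x : rnorm (a *: x) = rnorm a * rnorm x.
Proof. by apply: complexI; rewrite rmorphM /= -!norm_rnorm normrZ. Qed.

Lemma rnormM (a b : R[i]) : rnorm (a * b) = rnorm a * rnorm b.
Proof. by apply: complexI; rewrite rmorphM /= -!norm_rnorm normrM. Qed.

Lemma rnorm_real (r : R) : rnorm r%:C = `|r|.
Proof. by rewrite /rnorm normc_def /= expr0n addr0 sqrtr_sqr. Qed.

Lemma rnormZr (r : R) x : rnorm (r%:C *: x) = `|r| * rnorm x.
Proof. by rewrite rnormZ rnorm_real. Qed.

Lemma rnormJ a : rnorm (conjc a) = rnorm a.
Proof. by rewrite /rnorm normcJ. Qed.

Lemma ler_Re_rnorm a : Re a <= rnorm a.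
Proof.
by rewrite (le_trans (ler_norm _))// -lecR -norm_rnorm normc_ge_Re.
Qed.

Lemma rnorm_mulJ a : a * conjc a = (rnorm a ^+ 2)%:C.
Proof. by rewrite -sqr_normc norm_rnorm rmorphXn /=. Qed.

End Rnorm.

Section Inner.
Context {R : realType} {H : hilbertType R}.
Implicit Types (x y z : H) (a : R[i]).

Lemma innerDl x y z : inner (x + y) z = inner x z + inner y z.
Proof. exact: linearDl. Qed.
Lemma innerDr x y z : inner x (y + z) = inner x y + inner x z.
Proof. exact: linearDr. Qed.
Lemma innerBl x y z : inner (x - y) z = inner x z - inner y z.
Proof. exact: linearBl. Qed.
Lemma innerBr x y z : inner x (y - z) = inner x y - inner x z.
Proof. exact: linearBr. Qed.
Lemma innerZl a x y : inner (a *: x) y = a * inner x y.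
Proof. exact: linearZl_LR. Qed.
Lemma innerZr a x y : inner x (a *: y) = conjc a * inner x y.
Proof. exact: linearZr_LR. Qed.
Lemma inner0l y : inner 0 y = 0 :> R[i].
Proof. exact: linear0l. Qed.
Lemma inner0r x : inner x 0 = 0 :> R[i].
Proof. exact: linear0r. Qed.
Lemma innerC x y : inner x y = conjc (inner y x).
Proof. by rewrite hermC expr0 mul1r. Qed.
Lemma innerxx x : inner x x = (rnorm x ^+ 2)%:C.
Proof. by rewrite inner_norm norm_rnorm rmorphXn /=. Qed.
Lemma Re_innerC x y : Re (inner x y) = Re (inner y x).
Proof. by rewrite innerC; case: (inner y x). Qed.

Lemma rnormD_sqr x y :
  rnorm (x + y) ^+ 2 = rnorm x ^+ 2 + rnorm y ^+ 2 + 2 * Re (inner x y).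
Proof.
have: Re (inner (x + y) (x + y)) = rnorm (x + y) ^+ 2 by rewrite innerxx.
rewrite innerDl !innerDr !innerxx => <-.
rewrite !raddfD/= (Re_innerC y x); ring.
Qed.

Lemma rnormB_sqr x y :
  rnorm (x - y) ^+ 2 = rnorm x ^+ 2 + rnorm y ^+ 2 - 2 * Re (inner x y).
Proof.
rewrite rnormD_sqr rnormN -scaleN1r innerZr.
by rewrite rmorphN1 mulN1r raddfN/= mulrN.
Qed.

(** Nondegeneracy of the inner product is how identities between operators are
deduced from identities between sesquilinear forms. *)
Lemma inner_ext x y : (forall z, inner z x = inner z y) -> x = y.
Proof.
move=> h; apply/eqP; rewrite -subr_eq0; apply/eqP/rnorm0_eq0.
have := innerxx (x - y); rewrite innerBr h subrr => /complexI/esym/eqP.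
by rewrite sqrf_eq0 => /eqP.
Qed.

(** With [n] the norm of [y], expand the square of the norm of
[n ^+ 2 *: x - <x, y> *: y]: it equals [n ^+ 2] times the gap between the
squares of the two sides. *)
Lemma cauchy_schwarz x y : rnorm (inner x y) <= rnorm x * rnorm y.
Proof.
have [y0|y0] := eqVneq (rnorm y) 0.
  by rewrite (rnorm0_eq0 y0) inner0r !rnorm0 mulr0.
have yp : 0 < rnorm y by rewrite lt_def y0 rnorm_ge0.
have := sqr_ge0 (rnorm ((rnorm y ^+ 2)%:C *: x - inner x y *: y)).
rewrite rnormB_sqr rnormZr rnormZ innerZl innerZr.
rewrite [conjc _ * _]mulrC rnorm_mulJ -rmorphM/=.
rewrite ger0_norm ?sqr_ge0// => h.
rewrite -ler_sqr ?nnegrE ?mulr_ge0 ?rnorm_ge0// -subr_ge0.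
rewrite -(pmulr_rge0 _ (exprn_gt0 2 yp)).
apply: le_trans h _; rewrite le_eqVlt; apply/orP; left; apply/eqP; ring.
Qed.

End Inner.

(** * Bounded operators *)

Section BoundedOperators.
Context {R : realType} {H : hilbertType R}.
Implicit Types (x y z : H) (a : R[i]) (T S : H -> H).

Lemma op_linear T : bounded_operator T -> forall a x y, T (a *: x + y) = a *: T x + T y.
Proof. by case. Qed.

Lemma opD T : bounded_operator T -> forall x y, T (x + y) = T x + T y.
Proof. by move=> hT x y; have := op_linear hT 1 x y; rewrite !scale1r. Qed.

Lemma op0 T : bounded_operator T -> T 0 = 0.
Proof. by move=> hT; have := op_linear hT (-1) 0 0; rewrite scaler0 addr0 scaleN1r addNr. Qed.

Lemma opZ T : bounded_operator T -> forall a x, T (a *: x) = a *: T x.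
Proof. by move=> hT a x; have := op_linear hT a x 0; rewrite !addr0 (op0 hT) addr0. Qed.

Lemma opB T : bounded_operator T -> forall x y, T (x - y) = T x - T y.
Proof. by move=> hT x y; rewrite addrC -scaleN1r (op_linear hT) scaleN1r addrC. Qed.

Lemma bounded_ge0 T : bounded_operator T ->
  exists2 M : R, 0 <= M & forall x, rnorm (T x) <= M * rnorm x.
Proof.
move=> [_ [M hM]]; exists `|M| => // x.
by rewrite (le_trans (hM x))// ler_wpM2r ?rnorm_ge0// ler_norm.
Qed.

Lemma bounded_id : bounded_operator (id : H -> H).
Proof. by split=> //; exists 1 => x; rewrite mul1r. Qed.

Lemma bounded_comp T S :
  bounded_operator T -> bounded_operator S -> bounded_operator (T \o S).
Proof.
move=> hT hS; split=> [a x y /=|]; first by rewrite (op_linear hS) (op_linear hT).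
have [M M0 hM] := bounded_ge0 hT; have [N N0 hN] := bounded_ge0 hS.
exists (M * N) => x /=; rewrite (le_trans (hM _))// -mulrA ler_wpM2l//.
Qed.

Lemma bounded_add T S : bounded_operator T -> bounded_operator S ->
  bounded_operator (fun x => T x + S x).
Proof.
move=> hT hS; split=> [a x y /=|].
  by rewrite (op_linear hS) (op_linear hT) scalerDr addrACA.
have [M M0 hM] := bounded_ge0 hT; have [N N0 hN] := bounded_ge0 hS.
by exists (M + N) => x /=; rewrite (le_trans (rnormD _ _))// mulrDl lerD.
Qed.

Lemma bounded_scale a T : bounded_operator T -> bounded_operator (fun x => a *: T x).
Proof.
move=> hT; split=> [b x y /=|].
  by rewrite (op_linear hT) scalerDr !scalerA mulrC.
have [M M0 hM] := bounded_ge0 hT.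
by exists (rnorm a * M) => x /=; rewrite rnormZ -mulrA ler_wpM2l ?rnorm_ge0.
Qed.

Lemma bounded_sub T S : bounded_operator T -> bounded_operator S ->
  bounded_operator (fun x => T x - S x).
Proof.
move=> hT hS; have -> : (fun x => T x - S x) = (fun x => T x + (-1) *: S x).
  by apply/funext => x; rewrite scaleN1r.
by apply: bounded_add hT _; exact: bounded_scale.
Qed.

Lemma bounded_shift a T : bounded_operator T -> bounded_operator (fun x => T x - a *: x).
Proof. by move=> hT; apply: bounded_sub hT _; exact: (bounded_scale a bounded_id). Qed.

Lemma opnorm_le T (c : R) : 0 <= c ->
  (forall x, rnorm x = 1 -> rnorm (T x) <= c) -> opnorm T <= c.
Proof.
move=> c0 h; rewrite /opnorm.
have [->|/set0P n0] := eqVneq [set rnorm (T x) | x in [set x | rnorm x = 1]] set0.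
  by rewrite sup0.
by apply: ge_sup => // _ [x x1 <-]; exact: h.
Qed.

Lemma rnorm_normalize x : x != 0 -> rnorm (((rnorm x)^-1)%:C *: x) = 1.
Proof.
move=> x0; rewrite rnormZr ger0_norm ?invr_ge0 ?rnorm_ge0// mulVf//.
by apply: contra_neq x0; exact: rnorm0_eq0.
Qed.

Lemma le_opnorm T : bounded_operator T -> forall x, rnorm (T x) <= opnorm T * rnorm x.
Proof.
move=> hT x; have [->|x0] := eqVneq x 0; first by rewrite (op0 hT) !rnorm0 mulr0.
have xp : 0 < rnorm x.
  by rewrite lt_def rnorm_ge0 andbT; apply: contra_neq x0; exact: rnorm0_eq0.
rewrite -ler_pdivrMr// mulrC.
have -> : (rnorm x)^-1 * rnorm (T x) = rnorm (T (((rnorm x)^-1)%:C *: x)).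
  by rewrite (opZ hT) rnormZr ger0_norm// invr_ge0 ltW.
apply: ub_le_sup; last by exists (((rnorm x)^-1)%:C *: x) => //; exact: rnorm_normalize.
have [M M0 hM] := bounded_ge0 hT; exists M => _ [y /= y1 <-].
by rewrite (le_trans (hM y))// y1 mulr1.
Qed.

Lemma opnorm_ge0 T : 0 <= opnorm T.
Proof.
rewrite /opnorm; set A := (X in sup X).
have [->|/set0P n0] := eqVneq A set0; first by rewrite sup0.
have [hs|] := pselect (has_sup A); last by move=> /sup_out ->.
have [a Aa] := n0; apply: (le_trans _ (ub_le_sup (proj2 hs) Aa)).
by have [x _ <-] := Aa; exact: rnorm_ge0.
Qed.

Lemma opnorm_bound T (c : R) : 0 <= c ->
  (forall x, rnorm (T x) <= c * rnorm x) -> opnorm T <= c.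
Proof. by move=> c0 h; apply: opnorm_le => // x x1; rewrite (le_trans (h x))// x1 mulr1. Qed.

Lemma opnorm_comp T S : bounded_operator T -> bounded_operator S ->
  opnorm (T \o S) <= opnorm T * opnorm S.
Proof.
move=> hT hS; apply: opnorm_bound; first by rewrite mulr_ge0 ?opnorm_ge0.
move=> x /=; rewrite (le_trans (le_opnorm hT _))// -mulrA.
by rewrite ler_wpM2l ?opnorm_ge0// le_opnorm.
Qed.

(** Half of the equality of the norms of an operator and its adjoint; stated for
an arbitrary pair in duality, so that it serves for adjoints, for polynomials
in a self-adjoint operator and for reversed products of such operators. *)
Lemma opnorm_adjoint_pair T S : bounded_operator T -> bounded_operator S ->
  (forall x y, inner (T x) y = inner x (S y)) -> opnorm S <= opnorm T.
Proof.
move=> hT hS TS; apply: opnorm_bound; first exact: opnorm_ge0.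
move=> y; have [->|Sy0] := eqVneq (S y) 0.
  by rewrite rnorm0 mulr_ge0 ?rnorm_ge0 ?opnorm_ge0.
have Syp : 0 < rnorm (S y).
  by rewrite lt_def rnorm_ge0 andbT; apply: contra_neq Sy0; exact: rnorm0_eq0.
rewrite -(ler_pM2l Syp) -expr2.
have -> : rnorm (S y) ^+ 2 = Re (inner (T (S y)) y) by rewrite TS innerxx.
rewrite (le_trans (ler_Re_rnorm _))// (le_trans (cauchy_schwarz _ _))//.
rewrite mulrA [rnorm _ * opnorm _]mulrC ler_wpM2r ?rnorm_ge0//.
exact: le_opnorm.
Qed.

End BoundedOperators.

(** * Completeness, adjoints and coercive operators *)

Section Completeness.
Context {R : realType} {H : hilbertType R}.
Implicit Types (x y z : H) (a : R[i]) (T S B : H -> H).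

Lemma null_sequence_exists : exists d : nat -> R, (forall n, 0 < d n) /\
  forall e : R, 0 < e -> exists N, forall n, (N <= n)%N -> d n <= e.
Proof.
exists (fun n => n.+1%:R^-1); split=> [n|e e0]; first by rewrite invr_gt0.
exists (Num.truncn e^-1) => n Nn.
by rewrite invf_ple ?posrE// (le_trans (ltW (truncnS_gt _)))// ler_nat.
Qed.

Lemma cauchy_converges (u : nat -> H) :
  (forall e : R, 0 < e -> exists N, forall m n, (N <= m)%N -> (N <= n)%N ->
     rnorm (u m - u n) <= e) ->
  exists l, forall e : R, 0 < e -> exists N, forall n, (N <= n)%N ->
     rnorm (u n - l) <= e.
Proof.
move=> hu.
have /cauchy_cvgP ul : cauchy (u @ \oo).
  apply: cauchy_exP => e e0.
  have [eR eE] : exists r : R, e = r%:C.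
    by exists (Re e); rewrite RRe_real// gtr0_real.
  move: e0; rewrite {}eE ltcR => e0.
  have [N hN] := hu _ (divr_gt0 e0 (ltr0Sn R 1)).
  exists (u N); exists N => // n /= Nn; rewrite -ball_normE/=.
  rewrite norm_rnorm ltcR (le_lt_trans (hN _ _ (leqnn _) Nn))//.
  by rewrite gtr_pMr// invf_lt1// ltr1n.
exists (lim (u @ \oo)) => e e0.
have e0' : 0 < e%:C by rewrite ltcR.
have [N _ hN] := (cvgrPdist_le _ _).1 ul _ e0'.
exists N => n Nn; rewrite rnormBC -lecR -norm_rnorm; exact: hN.
Qed.

End Completeness.

Section CoerciveMinimization.
Context {R : realType} {H : hilbertType R}.
Implicit Types (x y z : H) (a : R[i]) (T S : H -> H).

Context (B : H -> H) (c K : R) (phi : H -> R[i]).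
Context (hB : bounded_operator B) (c0 : 0 < c)
  (cB : forall x, c * rnorm x <= rnorm (B x))
  (phiP : forall a x y, phi (a *: x + y) = a * phi x + phi y)
  (phiK : forall x, rnorm (phi x) <= K * rnorm x).

Let J x := rnorm (B x) ^+ 2 - 2 * Re (phi x).

Let phiD x y : phi (x + y) = phi x + phi y.
Proof. by have := phiP 1 x y; rewrite scale1r mul1r. Qed.

Let phi0 : phi 0 = 0.
Proof.
by apply/rnorm0_eq0/eqP; rewrite eq_le rnorm_ge0 andbT (le_trans (phiK 0))// rnorm0 mulr0.
Qed.

Let phiZ a x : phi (a *: x) = a * phi x.
Proof. by have := phiP a x 0; rewrite !addr0 phi0 addr0. Qed.

Let J_bounded x : - (K / c) ^+ 2 <= J x.
Proof.
have h1 := cB x; have h2 : Re (phi x) <= K * rnorm x.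
  exact: le_trans (ler_Re_rnorm _) (phiK x).
have h3 := rnorm_ge0 x; have h4 : c * c^-1 = 1 by rewrite divff// gt_eqF.
have h5 : (c * rnorm x) ^+ 2 <= rnorm (B x) ^+ 2.
  by rewrite ler_sqr ?nnegrE ?mulr_ge0 ?rnorm_ge0// ltW.
rewrite /J; apply: (@le_trans _ _ ((c * rnorm x) ^+ 2 - 2 * (K * rnorm x))); last lra.
rewrite -subr_ge0.
have -> : (c * rnorm x) ^+ 2 - 2 * (K * rnorm x) - - (K / c) ^+ 2 =
  (c * rnorm x - K / c) ^+ 2 + 2 * K * rnorm x * (c * c^-1 - 1) by ring.
by rewrite h4 subrr mulr0 addr0 sqr_ge0.
Qed.

Let J_line x h (s : R) : J (x + s%:C *: h) =
  J x + 2 * s * Re (inner (B h) (B x) - phi h) + s ^+ 2 * rnorm (B h) ^+ 2.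
Proof.
rewrite /J (opD hB) (opZ hB) phiD phiZ rnormD_sqr rnormZr.
rewrite [in Re (inner _ _)]Re_innerC innerZl exprMn.
rewrite real_normK ?num_real// !raddfD/= raddfN/=.
case: (inner _ _) => p q; case: (phi h) => v w; case: (phi x) => v' w' /=; ring.
Qed.

Let J_parallelogram x y : J x + J y - 2 * J (2^-1%:C *: (x + y)) =
  2^-1 * rnorm (B x - B y) ^+ 2.
Proof.
rewrite /J (opZ hB) (opD hB) phiZ phiD rnormZr rnormB_sqr exprMn rnormD_sqr.
rewrite ger0_norm ?invr_ge0//.
case: (phi x) => p q; case: (phi y) => v w /=; rewrite mul0r subr0; lra.
Qed.

(** The functional [J x = |B x|^2 - 2 Re phi(x)] is bounded below, and the
parallelogram identity together with [cB] makes its minimizing sequences Cauchy.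
At the limit the derivative of [J] along every line vanishes, which is the claim.
For [B = id] this is the Riesz representation theorem; for [phi] of the form
[<B h, y>] it projects [y] onto the range of [B]. *)
Lemma coercive_riesz : exists x, forall h, inner (B h) (B x) = phi h.
Proof.
pose A := [set J x | x in [set: H]].
have hA : has_inf A.
  split; first by exists (J 0), 0.
  by exists (- (K / c) ^+ 2) => _ [x _ <-]; exact: J_bounded.
have dJ x : inf A <= J x by apply: ge_inf; [exact: hA.2|exists x].
have [dl [dl0 small]] := @null_sequence_exists R.
have /choice[u hu] : forall n : nat, exists x, J x < inf A + dl n.
  by move=> n; have [_ [x _ <-] hx] := inf_adherent (dl0 n) hA; exists x.
have u_cauchy (e : R) : 0 < e -> exists N, forall m n, (N <= m)%N -> (N <= n)%N ->
    rnorm (u m - u n) <= e.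
  move=> e0; have ce0 : 0 < (c * e) ^+ 2 / 4 by rewrite divr_gt0// exprn_gt0// mulr_gt0.
  have [N hN] := small _ ce0.
  exists N => m n Nm Nn.
  have h1 := hN _ Nm; have h2 := hN _ Nn.
  have h3 := hu m; have h4 := hu n; have h5 := dJ (2^-1%:C *: (u m + u n)).
  have h6 := J_parallelogram (u m) (u n).
  have h7 : rnorm (B (u m - u n)) ^+ 2 <= (c * e) ^+ 2 by rewrite (opB hB); lra.
  rewrite -(ler_pM2l c0) (le_trans (cB _))// -ler_sqr// ?nnegrE ?rnorm_ge0//.
  by rewrite mulr_ge0// ltW.
have [x hx] := cauchy_converges u_cauchy; exists x => h.
have [M M0 hM] := bounded_ge0 hB.
(* Vanishing real parts suffice, because the form is linear in [k] and [k] may be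
   multiplied by 'i. *)
have Re0 k : Re (inner (B k) (B x) - phi k) = 0.
  pose E y := Re (inner (B k) (B y) - phi k).
  pose N := rnorm (B k).
  have EN n : E (u n) ^+ 2 <= dl n * (N ^+ 2 + 1).
    (* Up to the harmless [+ 1], which avoids dividing by 0, this is the minimizer
       of the quadratic polynomial [s |-> J (u n + s k)]. *)
    pose s := - E (u n) / (N ^+ 2 + 1).
    have := dJ (u n + s%:C *: k); rewrite J_line -/(E _) -/N => h1.
    have h2 := hu n; have N1 : 0 < N ^+ 2 + 1 by rewrite ltr_wpDl// sqr_ge0.
    have h3 : s * (N ^+ 2 + 1) = - E (u n) by rewrite /s divfK// gt_eqF.
    have h4 : 0 <= s ^+ 2 by exact: sqr_ge0.
    have h5 : 0 <= dl n + 2 * s * E (u n) + s ^+ 2 * N ^+ 2 by lra.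
    have h6 : 0 <= (dl n + 2 * s * E (u n) + s ^+ 2 * N ^+ 2) * (N ^+ 2 + 1).
      by rewrite mulr_ge0// ltW.
    have h7 : E (u n) = - (s * (N ^+ 2 + 1)) by lra.
    rewrite h7 in h6 *; rewrite -subr_ge0; apply: le_trans h6 _.
    rewrite -subr_ge0.
    have -> : dl n * (N ^+ 2 + 1) - (- (s * (N ^+ 2 + 1))) ^+ 2 -
      (dl n + 2 * s * - (s * (N ^+ 2 + 1)) + s ^+ 2 * N ^+ 2) * (N ^+ 2 + 1)
      = s ^+ 2 * (N ^+ 2 + 1) by ring.
    by rewrite mulr_ge0// ltW.
  have Ediff y : `|E x - E y| <= N * (M * rnorm (y - x)).
    have -> : E x - E y = Re (inner (B k) (B (x - y))).
      by rewrite (opB hB) innerBr /E !raddfB/=; ring.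
    have hle z : Re (inner (B k) (B z)) <= N * (M * rnorm z).
      rewrite (le_trans (ler_Re_rnorm _))// (le_trans (cauchy_schwarz _ _))//.
      by rewrite ler_wpM2l ?rnorm_ge0.
    rewrite ler_norml [rnorm (y - x)]rnormBC hle andbT lerNl.
    have -> : - Re (inner (B k) (B (x - y))) = Re (inner (B k) (B (y - x))).
      by rewrite !(opB hB) !innerBr !raddfB/=; ring.
    by rewrite rnormBC; exact: hle.
  apply/eqP; rewrite -normr_eq0 eq_le normr_ge0 andbT.
  apply/ler_addgt0Pr => e e0; rewrite add0r.
  have N0 : 0 <= N by exact: rnorm_ge0.
  have q0 : 0 < N * M + 1 by rewrite ltr_wpDl// mulr_ge0.
  have N1 : 0 < N ^+ 2 + 1 by rewrite ltr_wpDl// sqr_ge0.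
  have e2 : 0 < e / 2 by rewrite divr_gt0.
  have [N1' hN1] := hx _ (divr_gt0 e2 q0).
  have [N2 hN2] := small _ (divr_gt0 (exprn_gt0 2 e2) N1).
  pose n := maxn N1' N2.
  have h1 := hN1 n (leq_maxl _ _); have h2 := hN2 n (leq_maxr _ _).
  have h3 : `|E (u n)| <= e / 2.
    rewrite -ler_sqr ?nnegrE ?normr_ge0 ?(ltW e2)// real_normK ?num_real//.
    by rewrite (le_trans (EN n))// -ler_pdivlMr.
  have h4 : `|E x - E (u n)| <= e / 2.
    rewrite (le_trans (Ediff _))// mulrA.
    rewrite (@le_trans _ _ ((N * M + 1) * rnorm (u n - x)))//.
      by rewrite ler_wpM2r ?rnorm_ge0// lerDl.
    by rewrite mulrC -ler_pdivlMr.
  have := ler_normD (E x - E (u n)) (E (u n)); rewrite subrK -/(E x); lra.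
apply/eqP; rewrite -subr_eq0; apply/eqP.
have h1 := Re0 h; have := Re0 ('i%C *: h).
rewrite (opZ hB) innerZl phiZ -mulrBr.
case: (inner _ _ - _) h1 => p q /= -> /=; rewrite !(mul0r, mul1r, sub0r) => /eqP.
by rewrite oppr_eq0 => /eqP ->.
Qed.

End CoerciveMinimization.

Section Riesz.
Context {R : realType} {H : hilbertType R}.
Implicit Types (x y z : H) (a : R[i]) (T S A B : H -> H).

Lemma adjoint_exists A : bounded_operator A ->
  exists S, bounded_operator S /\ forall x y, inner (A x) y = inner x (S y).
Proof.
move=> hA.
have [M M0 hM] := bounded_ge0 hA.
have /choice[S hS] : forall y, exists w, forall x, inner x w = inner (A x) y.
  move=> y; apply: (@coercive_riesz _ _ id 1 (M * rnorm y) (fun x => inner (A x) y)) => //.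
  - exact: bounded_id.
  - by move=> x; rewrite mul1r.
  - by move=> a x x'; rewrite (op_linear hA) innerDl innerZl.
  - by move=> x; rewrite (le_trans (cauchy_schwarz _ _))// mulrAC ler_wpM2r ?rnorm_ge0.
have hS' x y : inner (A x) y = inner x (S y) by [].
exists S; split=> //; split.
  by move=> a x y; apply: inner_ext => z; rewrite -hS' !(innerDr, innerZr) !hS'.
exists M => y; have [->|Sy0] := eqVneq (S y) 0.
  by rewrite rnorm0 mulr_ge0 ?rnorm_ge0.
have Syp : 0 < rnorm (S y).
  by rewrite lt_def rnorm_ge0 andbT; apply: contra_neq Sy0; exact: rnorm0_eq0.
rewrite -(ler_pM2l Syp) -expr2.
have -> : rnorm (S y) ^+ 2 = Re (inner (A (S y)) y) by rewrite hS' innerxx.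
rewrite (le_trans (ler_Re_rnorm _))// (le_trans (cauchy_schwarz _ _))//.
by rewrite mulrA [rnorm _ * M]mulrC ler_wpM2r ?rnorm_ge0.
Qed.

Lemma adjointP A : bounded_operator A ->
  bounded_operator (adjoint A) /\ forall x y, inner (A x) y = inner x (adjoint A y).
Proof. by move=> /adjoint_exists hS; exact: (getPex hS). Qed.

Lemma bounded_adjoint A : bounded_operator A -> bounded_operator (adjoint A).
Proof. by move=> /adjointP[]. Qed.

Lemma inner_adjointr A : bounded_operator A ->
  forall x y, inner x (adjoint A y) = inner (A x) y.
Proof. by move=> /adjointP[_ h] x y. Qed.

Lemma inner_adjointl A : bounded_operator A ->
  forall x y, inner (adjoint A x) y = inner x (A y).
Proof. by move=> hA x y; rewrite innerC inner_adjointr// -innerC. Qed.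

Lemma adjointK A : bounded_operator A -> adjoint (adjoint A) = A.
Proof.
move=> hA; have hA' := bounded_adjoint hA.
apply/funext => y; apply: inner_ext => x.
by rewrite inner_adjointr// inner_adjointl.
Qed.

(** Lax and Milgram: coercivity gives injectivity and a bound for the inverse, and
the residual [B x - y] of the projection of [y] onto the range of [B] is
orthogonal to its own image, hence zero by coercivity again. *)
Lemma coercive_invertible B (c : R) : bounded_operator B -> 0 < c ->
  (forall x, c * rnorm x ^+ 2 <= rnorm (inner (B x) x)) ->
  exists S, [/\ bounded_operator S, cancel S B & cancel B S].
Proof.
move=> hB c0 hc.
have cB x : c * rnorm x <= rnorm (B x).
  have [->|x0] := eqVneq x 0; first by rewrite (op0 hB) rnorm0 mulr0.
  have xp : 0 < rnorm x.
    by rewrite lt_def rnorm_ge0 andbT; apply: contra_neq x0; exact: rnorm0_eq0.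
  rewrite -(ler_pM2r xp) -mulrA -expr2 (le_trans (hc x))//.
  exact: cauchy_schwarz.
have Binj : injective B.
  move=> x y e; apply/eqP; rewrite -subr_eq0; apply/eqP/rnorm0_eq0.
  apply/eqP; rewrite eq_le rnorm_ge0 andbT -(pmulr_rle0 _ c0).
  by rewrite (le_trans (cB _))// (opB hB) e subrr rnorm0.
have [M M0 hM] := bounded_ge0 hB.
have /choice[S SB] : forall y, exists x, B x = y.
  move=> y.
  have [x hx] : exists x, forall h, inner (B h) (B x) = inner (B h) y.
    apply: (@coercive_riesz _ _ B c (M * rnorm y) (fun h => inner (B h) y)) => //.
    - by move=> a x x'; rewrite (op_linear hB) innerDl innerZl.
    - by move=> x; rewrite (le_trans (cauchy_schwarz _ _))// mulrAC ler_wpM2r ?rnorm_ge0.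
  exists x; apply/eqP; rewrite -subr_eq0; apply/eqP/rnorm0_eq0/eqP.
  have := hc (B x - y); rewrite innerBr hx subrr rnorm0 pmulr_rle0// => h.
  by rewrite -sqrf_eq0 eq_le h sqr_ge0.
exists S; split=> //; last by move=> x; apply: Binj; rewrite SB.
split; first by move=> a x y; apply: Binj; rewrite (op_linear hB) !SB.
by exists c^-1 => y; rewrite mulrC ler_pdivlMr// mulrC (le_trans (cB _))// SB.
Qed.

End Riesz.

(** * Polynomials in a self-adjoint operator *)

Section PolynomialCalculus.
Context {R : realType} {H : hilbertType R}.
Implicit Types (x y z : H) (a c : R[i]) (T S : H -> H) (p q : {poly R[i]}).

Lemma poly_op_widen n p T x : (size p <= n)%N ->
  poly_op p T x = \sum_(i < n) p`_i *: iter i T x.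
Proof.
move=> pn; rewrite /poly_op (big_ord_widen n (fun i => p`_i *: iter i T x) pn).
rewrite big_mkcond/=; apply: eq_bigr => i _; case: ltnP => // ni.
by rewrite nth_default// scale0r.
Qed.

Lemma poly_opD p q T x : poly_op (p + q) T x = poly_op p T x + poly_op q T x.
Proof.
pose n := maxn (size p) (size q).
rewrite (@poly_op_widen n) ?size_polyD// (@poly_op_widen n p) ?leq_maxl//.
rewrite (@poly_op_widen n q) ?leq_maxr// -big_split/=.
by apply: eq_bigr => i _; rewrite coefD scalerDl.
Qed.

Lemma poly_opZ c p T x : poly_op (c *: p) T x = c *: poly_op p T x.
Proof.
rewrite (@poly_op_widen (size p)) ?size_scale_leq// scaler_sumr.
by apply: eq_bigr => i _; rewrite coefZ scalerA.
Qed.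

Lemma poly_opB p q T x : poly_op (p - q) T x = poly_op p T x - poly_op q T x.
Proof. by rewrite poly_opD -scaleN1r poly_opZ scaleN1r. Qed.

Lemma poly_opC c T x : poly_op c%:P T x = c *: x.
Proof. by rewrite (@poly_op_widen 1) ?size_polyC_leq1// big_ord1 coefC. Qed.

Lemma poly_opMX p T x : poly_op (p * 'X) T x = poly_op p T (T x).
Proof.
rewrite (@poly_op_widen (size p).+1); last first.
  by rewrite (leq_trans (size_polyMleq _ _))// size_polyX addn2.
rewrite big_ord_recl coefMX eqxx scale0r add0r; apply: eq_bigr => i _.
by rewrite coefMX/= -iterSr.
Qed.

Lemma poly_opX T x : poly_op 'X T x = T x.
Proof. by rewrite -['X]mul1r poly_opMX poly_opC scale1r. Qed.

Lemma poly_op0 T x : poly_op 0 T x = 0.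
Proof. by rewrite -polyC0 poly_opC scale0r. Qed.

Lemma poly_op_intertwine p A T S x : bounded_operator A ->
  (forall x, A (T x) = S (A x)) -> A (poly_op p T x) = poly_op p S (A x).
Proof.
move=> hA AT; elim/poly_ind: p x => [|p c IH] x; first by rewrite !poly_op0 (op0 hA).
by rewrite !poly_opD !poly_opMX !poly_opC (opD hA) (opZ hA) IH AT.
Qed.

Lemma poly_opM p q T x : bounded_operator T ->
  poly_op (p * q) T x = poly_op p T (poly_op q T x).
Proof.
move=> hT; elim/poly_ind: p q x => [|p c IH] q x; first by rewrite mul0r !poly_op0.
rewrite mulrDl -mulrA ['X * q]mulrC !poly_opD mul_polyC poly_opZ IH !poly_opMX.
by rewrite poly_opC (poly_op_intertwine (S := T) _ _ hT).
Qed.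

Lemma bounded_poly_op p T : bounded_operator T -> bounded_operator (poly_op p T).
Proof.
move=> hT; elim/poly_ind: p => [|p c IH].
  have -> : poly_op 0 T = (fun x => 0 *: x).
    by apply/funext => x; rewrite poly_op0 scale0r.
  exact: (bounded_scale 0 bounded_id).
have -> : poly_op (p * 'X + c%:P) T = (fun x => (poly_op p T \o T) x + c *: x).
  by apply/funext => x; rewrite poly_opD poly_opMX poly_opC.
exact: bounded_add (bounded_comp IH hT) (bounded_scale c bounded_id).
Qed.

End PolynomialCalculus.

Section SelfAdjoint.
Context {R : realType} {H : hilbertType R}.
Implicit Types (x y : H) (z a c : R[i]) (T S : H -> H) (p q : {poly R[i]}).

Definition selfadjoint T :=
  bounded_operator T /\ forall x y, inner (T x) y = inner x (T y).

Definition positive_op T :=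
  selfadjoint T /\ forall x, 0 <= Re (inner (T x) x).

Definition invertible T :=
  exists S, [/\ bounded_operator S, cancel S T & cancel T S].

Lemma invertible_comp T S : invertible T -> invertible S -> invertible (T \o S).
Proof.
move=> [T' [hT' TT' T'T]] [S' [hS' SS' S'S]]; exists (S' \o T').
by split; [exact: bounded_comp|exact: can_comp|exact: can_comp].
Qed.

Lemma spectrumP T z : spectrum T z <-> ~ invertible (fun x => T x - z *: x).
Proof. by split=> h [S [hS h1 h2]]; apply: h; exists S; split. Qed.

Lemma notin_spectrum T z : ~ spectrum T z -> invertible (fun x => T x - z *: x).
Proof. by move=> h; apply: contrapT => h'; apply: h; apply/spectrumP. Qed.

(** Over the algebraically closed field of complex numbers, [q] splits into linear
factors. If no root of [q] were in the spectrum of [T], then [q(T)] would be a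
product of invertible operators. *)
Lemma spectral_mapping T q : bounded_operator T -> q != 0 ->
  ~ invertible (poly_op q T) -> exists2 z, spectrum T z & q.[z] = 0.
Proof.
move=> hT q0 hq; apply: contrapT => nz; apply: hq.
have [rs qE] := closed_field_poly_normal q.
have lq0 : lead_coef q != 0 by rewrite lead_coef_eq0.
have rsP : forall z, z \in rs -> ~ spectrum T z.
  move=> z zrs Tz; apply: nz; exists z => //.
  apply/eqP; rewrite -/(root q z) qE rootZ// root_prod_XsubC.
  exact: zrs.
have prodP : invertible (poly_op (\prod_(z <- rs) ('X - z%:P)) T).
  elim: rs {qE} rsP => [_|z rs IH rsP].
    exists id; split; first exact: bounded_id.
      by move=> x; rewrite big_nil -polyC1 poly_opC scale1r.
    by move=> x; rewrite big_nil -polyC1 poly_opC scale1r.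
  have -> : poly_op (\prod_(j <- z :: rs) ('X - j%:P)) T =
    (fun x => T x - z *: x) \o poly_op (\prod_(j <- rs) ('X - j%:P)) T.
    apply/funext => x; rewrite big_cons poly_opM// poly_opB poly_opX poly_opC//.
  apply: invertible_comp.
    by apply: notin_spectrum; apply: rsP; rewrite mem_head.
  by apply: IH => w ws; apply: rsP; rewrite inE ws orbT.
rewrite qE; have -> : poly_op (lead_coef q *: \prod_(z <- rs) ('X - z%:P)) T =
   (fun x => lead_coef q *: x) \o poly_op (\prod_(z <- rs) ('X - z%:P)) T.
  by apply/funext => x /=; rewrite poly_opZ.
apply: invertible_comp prodP.
exists (fun x => (lead_coef q)^-1 *: x); split.
- exact: (bounded_scale _ bounded_id).
- by move=> x; rewrite scalerA divff// scale1r.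
- by move=> x; rewrite scalerA mulVf// scale1r.
Qed.

Lemma inner_real T : selfadjoint T -> forall x, complex.Im (inner (T x) x) = 0.
Proof.
move=> [_ h] x; have := innerC (T x) x; rewrite -h.
by case: (inner _ _) => u v [] /= /eqP; rewrite -subr_eq0 opprK -mulr2n mulrn_eq0 => /eqP.
Qed.

Lemma ler_Im_rnorm a : `|complex.Im a| <= rnorm a.
Proof.
rewrite -ler_sqr ?nnegrE ?normr_ge0 ?rnorm_ge0// real_normK ?num_real//.
rewrite -lecR [leRHS]rmorphXn/= -norm_rnorm -add_Re2_Im2 lecR lerDr sqr_ge0//.
Qed.

(** The imaginary part of [<(T - z) x, x>] is [- Im z |x|^2], so [T - z] is coercive
off the real axis. *)
Lemma spectrum_real T z : selfadjoint T -> spectrum T z -> z = (Re z)%:C.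
Proof.
move=> sT /spectrumP Tz; have [Im0|Im0] := eqVneq (complex.Im z) 0.
  by case: z Tz Im0 => u v /= _ ->.
exfalso; apply: Tz; apply: (@coercive_invertible _ _ _ `|complex.Im z|).
- by apply: bounded_shift; case: sT.
- by rewrite normr_gt0.
move=> x; apply: le_trans (ler_Im_rnorm _).
rewrite innerBl innerZl innerxx raddfB/= inner_real// sub0r normrN.
by case: z {Im0} => u v /=; rewrite mulr0 add0r normrM [`|_ ^+ 2|]ger0_norm// sqr_ge0.
Qed.

(** Outside the interval, [T - z] or its opposite is coercive. *)
Lemma spectrum_positive T z : positive_op T -> spectrum T z -> 0 <= Re z <= opnorm T.
Proof.
move=> pT Tz; have [sT posT] := pT; have bT := sT.1.
have zE := spectrum_real sT Tz.
have RezE x : Re (inner (T x - z *: x) x) = Re (inner (T x) x) - Re z * rnorm x ^+ 2.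
  by rewrite innerBl innerZl innerxx zE -rmorphM raddfB/=.
move/spectrumP : Tz => Tz; apply/andP; split.
  rewrite leNgt; apply/negP => z0; apply: Tz.
  apply: (@coercive_invertible _ _ _ (- Re z)); first exact: bounded_shift.
    by rewrite oppr_gt0.
  move=> x; apply: le_trans (ler_Re_rnorm _); rewrite RezE mulNr lerDr; exact: posT.
rewrite leNgt; apply/negP => z0; apply: Tz.
apply: (@coercive_invertible _ _ _ (Re z - opnorm T)); first exact: bounded_shift.
  by rewrite subr_gt0.
move=> x; rewrite -[leRHS]rnormN; apply: le_trans (ler_Re_rnorm _); rewrite raddfN/= RezE opprB.
rewrite mulrBl lerD2l lerN2 (le_trans (ler_Re_rnorm _))//.
by rewrite (le_trans (cauchy_schwarz _ _))// expr2 mulrA ler_wpM2r ?rnorm_ge0// le_opnorm.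
Qed.

Lemma poly_op_adjoint T p : selfadjoint T -> forall x y,
  inner (poly_op p T x) y = inner x (poly_op (map_poly conjc p) T y).
Proof.
move=> [hT sT]; elim/poly_ind: p => [|p c IH] x y.
  by rewrite rmorph0 !poly_op0 inner0l inner0r.
rewrite rmorphD rmorphM/= map_polyX map_polyC/= !poly_opD !poly_opMX !poly_opC.
rewrite innerDl innerDr innerZl innerZr. rewrite conjcK IH sT.
by rewrite (poly_op_intertwine (S := T) _ _ hT).
Qed.

(** Let [M] be the norm of [p(T)]. Vectors [x] of norm 1 that nearly attain it are
approximate eigenvectors of [p(T)^* p(T)] for [M ^+ 2]:
[|p(T)^* p(T) x - M^2 x|^2 <= 2 M^2 (M^2 - |p(T) x|^2)].
A bounded inverse would keep the left-hand side away from 0. The vector [x0]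
witnesses that the space is not trivial. *)
Lemma opnorm_sqr_in_spectrum T p x0 : selfadjoint T -> rnorm x0 = 1 ->
  let r := map_poly conjc p * p - ((opnorm (poly_op p T)) ^+ 2)%:C%:P in
  ~ invertible (poly_op r T).
Proof.
move=> sT x01; have hT := sT.1; set M := opnorm _; move=> r [S [hS rS Sr]].
have hp := bounded_poly_op p hT.
pose p' := map_poly conjc p.
have hp' := bounded_poly_op p' hT.
have M0 : 0 <= M by exact: opnorm_ge0.
have rE x : poly_op r T x = poly_op p' T (poly_op p T x) - (M ^+ 2)%:C *: x.
  by rewrite poly_opB poly_opM// poly_opC.
have p'M x : rnorm (poly_op p' T x) <= M * rnorm x.
  rewrite (le_trans (le_opnorm hp' _))// ler_wpM2r ?rnorm_ge0//.
  by apply: opnorm_adjoint_pair => //; exact: poly_op_adjoint.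
have rx x : rnorm x = 1 ->
    rnorm (poly_op r T x) ^+ 2 <= 2 * M ^+ 2 * (M ^+ 2 - rnorm (poly_op p T x) ^+ 2).
  move=> x1; rewrite rE rnormB_sqr rnormZr x1 mulr1 innerZr conjc_real.
  have -> : inner (poly_op p' T (poly_op p T x)) x = (rnorm (poly_op p T x) ^+ 2)%:C.
    by rewrite innerC -poly_op_adjoint// innerxx conjc_real.
  rewrite -rmorphM/=.
  have h : rnorm (poly_op p' T (poly_op p T x)) ^+ 2 <= (M ^+ 2) ^+ 2.
    rewrite ler_sqr ?nnegrE ?rnorm_ge0 ?exprn_ge0// (le_trans (p'M _))//.
    by rewrite expr2 ler_wpM2l// (le_trans (le_opnorm hp _))// x1 mulr1.
  rewrite ger0_norm ?sqr_ge0//; lra.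
have [K K0 hK] := bounded_ge0 hS.
have K1 x : rnorm x = 1 -> 1 <= K ^+ 2 * rnorm (poly_op r T x) ^+ 2.
  move=> x1; rewrite -exprMn -[leLHS](expr1n _ 2) ler_sqr ?nnegrE ?mulr_ge0 ?rnorm_ge0//.
  by rewrite -[leLHS]x1 -{1}(Sr x).
have L0 : 0 <= 2 * K ^+ 2 * M ^+ 2 by rewrite !mulr_ge0 ?exprn_ge0.
have L1 x : rnorm x = 1 ->
    1 <= 2 * K ^+ 2 * M ^+ 2 * (M ^+ 2 - rnorm (poly_op p T x) ^+ 2).
  move=> x1; rewrite (le_trans (K1 _ x1))//.
  rewrite (le_trans (ler_wpM2l _ (rx _ x1))) ?exprn_ge0//.
  rewrite le_eqVlt; apply/orP; left; apply/eqP; ring.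
have Lp : 0 < 2 * K ^+ 2 * M ^+ 2.
  rewrite lt_def L0 andbT; apply/eqP => L00.
  by have := L1 _ x01; rewrite L00 mul0r ler10.
have pM x : rnorm x = 1 ->
    rnorm (poly_op p T x) <= Num.sqrt (M ^+ 2 - (2 * K ^+ 2 * M ^+ 2)^-1).
  move=> x1; rewrite -[leLHS]ger0_norm ?rnorm_ge0// -sqrtr_sqr ler_wsqrtr//.
  by have := L1 _ x1; rewrite -ler_pdivrMl// mulr1; lra.
have := opnorm_le (sqrtr_ge0 _) pM; rewrite -/M.
have Mp : 0 < M by rewrite lt_def M0 andbT; apply: contraTneq Lp => ->; rewrite expr0n mulr0 ltxx.
apply/negP; rewrite -ltNge.
have [h|h] := leP 0 (M ^+ 2 - (2 * K ^+ 2 * M ^+ 2)^-1); last by rewrite ler0_sqrtr// ltW.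
rewrite -ltr_sqr ?nnegrE ?sqrtr_ge0// sqr_sqrtr// ltrBlDr ltrDl invr_gt0//.
Qed.

(** The estimate on which the functional calculus rests: on a nonzero space, the norm
of [p(T)] is the modulus of [p] at some point of the spectrum. When [conj(p) p - M^2] is the zero
polynomial, spectral mapping says nothing, and [p = 'X] is used to find a point of
the spectrum. *)
Lemma opnorm_poly_op_le T p (c : R) : selfadjoint T -> 0 <= c ->
  (forall z, spectrum T z -> rnorm p.[z] <= c) -> opnorm (poly_op p T) <= c.
Proof.
move=> sT c0 hc; have hT := sT.1.
have [[x0 x01]|nx] := pselect (exists x : H, rnorm x = 1); last first.
  by apply: opnorm_le => // x x1; exfalso; apply: nx; exists x.
have eval q z : spectrum T z -> (map_poly conjc q * q).[z] = (rnorm q.[z] ^+ 2)%:C.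
  move=> Tz; rewrite hornerM -rnorm_mulJ mulrC; congr (_ * _).
  by rewrite {1}(spectrum_real sT Tz) -(conjc_real (Re z)) horner_map/= -(spectrum_real sT Tz).
pose r q := map_poly conjc q * q - ((opnorm (poly_op q T)) ^+ 2)%:C%:P.
have attained q : r q != 0 -> exists2 z, spectrum T z & (r q).[z] = 0.
  by move=> rq0; apply: spectral_mapping => //; exact: (opnorm_sqr_in_spectrum sT x01).
have [z Tz rz] : exists2 z, spectrum T z & (r p).[z] = 0.
  have [r0|] := eqVneq (r p) 0; last exact: attained.
  have [|z Tz _] := attained 'X; last by exists z => //; rewrite r0 horner0.
  rewrite -size_poly_gt0 /r map_polyX -expr2.
  rewrite size_polyDl ?size_polyXn// size_polyN.
  by rewrite (leq_ltn_trans (size_polyC_leq1 _)).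
move: rz; rewrite hornerD hornerN hornerC eval// => /eqP.
rewrite subr_eq0 => /eqP/complexI/eqP; rewrite eqrXn2 ?rnorm_ge0 ?opnorm_ge0//.
by move=> /eqP <-; exact: hc.
Qed.

End SelfAdjoint.

(** * Polynomial approximation of powers *)

Section Weierstrass.
Context {R : realType}.
Implicit Types (f g : nat -> R) (x y e d s : R).

(** The Bernstein polynomial of the values [f 0, ..., f n], in the recursive form of
de Casteljau: it makes positivity and the first moments direct inductions,
without binomial sums. *)
Fixpoint bernstein n f : {poly R} :=
  if n is m.+1 then (1 - 'X) * bernstein m f + 'X * bernstein m (f \o succn)
  else (f 0)%:P.

Lemma horner_bernsteinS n f x : (bernstein n.+1 f).[x] =
  (1 - x) * (bernstein n f).[x] + x * (bernstein n (f \o succn)).[x].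
Proof. by rewrite /= !hornerE. Qed.

Lemma ler_bernstein n f g x : 0 <= x <= 1 ->
  (forall k, (k <= n)%N -> f k <= g k) -> (bernstein n f).[x] <= (bernstein n g).[x].
Proof.
move=> /andP[x0 x1]; elim: n f g => [|n IH] f g fg.
  by rewrite !hornerC fg.
rewrite !horner_bernsteinS lerD// ler_wpM2l ?subr_ge0//; apply: IH => k kn.
  exact/fg/leqW.
exact: fg.
Qed.

(** The mean and the variance of the binomial law. *)
Lemma bernstein_quadratic n (a b c x : R) :
  (bernstein n (fun k => a + b * (k%:R - c) ^+ 2)).[x] =
  a + b * (n%:R * x * (1 - x) + (n%:R * x - c) ^+ 2).
Proof.
elim: n c => [|n IH] c; first by rewrite hornerC; ring.
rewrite horner_bernsteinS IH.
have -> : (fun k => a + b * (k%:R - c) ^+ 2) \o succn =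
    (fun k : nat => a + b * (k%:R - (c - 1)) ^+ 2).
  by apply/funext => k /=; rewrite -natr1; ring.
by rewrite IH -natr1; ring.
Qed.

(** Chebyshev's argument: a quadratic modulus at [x] is averaged exactly by
[bernstein_quadratic], and only the variance, at most [1 / n.+1] after scaling,
remains. *)
Lemma bernstein_approx n (f : R -> R) e (K : R) x : 0 <= x <= 1 -> 0 <= K ->
  (forall y, 0 <= y <= 1 -> `|f y - f x| <= e + K * (y - x) ^+ 2) ->
  `|(bernstein n.+1 (fun k => f (k%:R / n.+1%:R))).[x] - f x| <= e + K / n.+1%:R.
Proof.
move=> x01 K0 hf; set N : R := n.+1%:R; have N0 : 0 < N by rewrite ltr0Sn.
have hk k : (k <= n.+1)%N ->
    `|f (k%:R / N) - f x| <= e + K / N ^+ 2 * (k%:R - N * x) ^+ 2.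
  move=> kn; have -> : K / N ^+ 2 * (k%:R - N * x) ^+ 2 = K * (k%:R / N - x) ^+ 2.
    by field; rewrite gt_eqF.
  by apply: hf; rewrite divr_ge0 ?(ltW N0)//= ler_pdivrMr// mul1r ler_nat.
have hv : K / N ^+ 2 * (N * x * (1 - x)) <= K / N.
  have -> : K / N ^+ 2 * (N * x * (1 - x)) = K / N * (x * (1 - x)).
    by field; rewrite gt_eqF.
  case/andP: x01 => x0 x1.
  rewrite -[leRHS]mulr1 ler_wpM2l ?divr_ge0 ?(ltW N0)// mulr_ile1 ?subr_ge0//; lra.
rewrite ler_norml; apply/andP; split.
  rewrite lerBrDr.
  apply: (@le_trans _ _ (bernstein n.+1
      (fun k => (f x - e) + (- (K / N ^+ 2)) * (k%:R - N * x) ^+ 2)).[x]).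
    rewrite bernstein_quadratic -/N subrr expr0n addr0 mulNr.
    by move: hv; set q := _ * (N * _ * _); set r := K / N; lra.
  apply: ler_bernstein => // k kn; have := hk k kn; rewrite ler_norml ?mulNr => /andP[].
  by set q := _ * (_ ^+ 2); set r := f (_ / _); lra.
rewrite lerBlDr.
apply: (@le_trans _ _ (bernstein n.+1
      (fun k => (f x + e) + K / N ^+ 2 * (k%:R - N * x) ^+ 2)).[x]).
  apply: ler_bernstein => // k kn; have := hk k kn; rewrite ler_norml ?mulNr => /andP[].
  by set q := _ * (_ ^+ 2); set r := f (_ / _); lra.
rewrite bernstein_quadratic -/N subrr expr0n addr0.
by move: hv; set q := _ * (N * _ * _); set r := K / N; lra.
Qed.

(** Boundedness turns uniform continuity into a quadratic modulus: when the
points are at least [d] apart, [2 * C] is at most [2 * C * ((x - y) / d) ^+ 2]. *)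
Lemma weierstrass (f : R -> R) (M C : R) : 0 < M ->
  (forall x, 0 <= x <= M -> `|f x| <= C) ->
  (forall e, 0 < e -> exists2 d, 0 < d & forall x y, 0 <= x <= M -> 0 <= y <= M ->
     `|x - y| <= d -> `|f x - f y| <= e) ->
  forall e, 0 < e -> exists p : {poly R}, forall x, 0 <= x <= M -> `|p.[x] - f x| <= e.
Proof.
move=> M0 fC fu e e0; have e2 : 0 < e / 2 by rewrite divr_gt0.
have [d d0 hd] := fu _ e2.
have C0 : 0 <= C by apply: le_trans (normr_ge0 (f 0)) (fC _ _); rewrite lexx ltW.
pose K := 2 * C * (M / d) ^+ 2.
have K0 : 0 <= K by exact: mulr_ge0 (mulr_ge0 (ler0n _ 2) C0) (sqr_ge0 _).
pose n := Num.truncn (K / (e / 2)).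
have Kn : K / n.+1%:R <= e / 2.
  by rewrite ler_pdivrMr// mulrC -ler_pdivrMr// ltW// truncnS_gt.
pose g u := f (M * u).
exists (bernstein n.+1 (fun k => g (k%:R / n.+1%:R)) \Po (M^-1 *: 'X)) => x /andP[x0 xM].
rewrite horner_comp hornerZ hornerX.
have u01 : 0 <= M^-1 * x <= 1.
  by rewrite mulr_ge0 ?invr_ge0 ?(ltW M0)//= ler_pdivrMl// mulr1.
have -> : f x = g (M^-1 * x) by rewrite /g mulrA divff ?mul1r// gt_eqF.
apply: le_trans (bernstein_approx n u01 K0 (e := e / 2) _) _; last first.
  by move: Kn; set r := K / _; lra.
move: u01; set u := M^-1 * x => u01 v v01.
have inM w : 0 <= w <= 1 -> 0 <= M * w <= M.
  by case/andP=> w0 w1; rewrite mulr_ge0 ?(ltW M0)//= ger_pMr.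
have [small|big] := leP `|M * v - M * u| d.
  apply: le_trans (hd _ _ (inM _ v01) (inM _ u01) small) _.
  by rewrite lerDl mulr_ge0 ?sqr_ge0.
have h1 : `|g v - g u| <= 2 * C.
  rewrite (le_trans (ler_normB _ _))//.
  by have := fC _ (inM _ v01); have := fC _ (inM _ u01); rewrite /g; lra.
apply: le_trans h1 _.
have h2 : 1 <= (M / d) ^+ 2 * (v - u) ^+ 2.
  rewrite -exprMn -real_normK ?num_real// -[leLHS](expr1n _ 2).
  rewrite ler_sqr ?nnegrE ?normr_ge0// mulrAC -mulrBr in big *.
  by rewrite normrM [`|d^-1|]gtr0_norm ?invr_gt0// ler_pdivlMr// mul1r ltW// mulrBr.
have h3 : 0 <= 2 * C by rewrite mulr_ge0.
have := ler_wpM2l h3 h2; rewrite /K; lra.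
Qed.

(** With [c = x + y], the power [(z / c) `^ s] dominates [z / c] for [z = x] and
[z = y], and these two quotients add up to 1. *)
Lemma powR_subadditive s x y : 0 <= s <= 1 -> 0 <= x -> 0 <= y ->
  (x + y) `^ s <= x `^ s + y `^ s.
Proof.
move=> /andP[s0 s1] x0 y0.
have [->|xn0] := eqVneq x 0; first by rewrite add0r lerDr powR_ge0.
have [->|yn0] := eqVneq y 0; first by rewrite addr0 lerDl powR_ge0.
have xp : 0 < x by rewrite lt_def xn0.
have yp : 0 < y by rewrite lt_def yn0.
have c0 : 0 < x + y by rewrite addr_gt0.
have part z : 0 < z -> z <= x + y -> (x + y) `^ s * (z / (x + y)) <= z `^ s.
  move=> z0 zc; have q0 : 0 <= z / (x + y) by rewrite divr_ge0 ?(ltW z0) ?(ltW c0).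
  rewrite -[in leRHS](divfK (lt0r_neq0 c0) z) (powRM _ q0 (ltW c0)).
  rewrite [leLHS]mulrC ler_wpM2r ?powR_ge0//; apply: ger1_powR => //.
  by rewrite divr_gt0//= ler_pdivrMr// mul1r.
apply: le_trans (lerD (part _ xp _) (part _ yp _)); rewrite ?lerDl ?lerDr//.
by rewrite -mulrDr -mulrDl divff ?mulr1// gt_eqF.
Qed.

Lemma powR_uniformly_continuous s e : 0 <= s <= 1 -> 0 < e ->
  exists2 d, 0 < d & forall x y, 0 <= x -> 0 <= y -> `|x - y| <= d ->
    `|x `^ s - y `^ s| <= e.
Proof.
move=> s01 e0; have /andP[s0 s1] := s01.
have [->|sn0] := eqVneq s 0.
  by exists 1 => // x y _ _ _; rewrite !powRr0 subrr normr0 ltW.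
exists (e `^ s^-1); first exact: powR_gt0.
have sub x y : 0 <= y <= x -> x - y <= e `^ s^-1 -> `|x `^ s - y `^ s| <= e.
  move=> /andP[y0 yx] xyd; have xy0 : 0 <= x - y by rewrite subr_ge0.
  have := powR_subadditive s01 xy0 y0; rewrite subrK => h.
  have h1 : (x - y) `^ s <= e.
    rewrite -[leRHS]powRr1 ?(ltW e0)// -(mulVf sn0) powRrM.
    by apply: ge0_ler_powR; rewrite ?nnegrE ?powR_ge0.
  rewrite ger0_norm; first by lra.
  by rewrite subr_ge0; apply: ge0_ler_powR; rewrite ?nnegrE// (le_trans y0).
move=> x y x0 y0; have [xy|yx] := leP x y.
  rewrite distrC ger0_norm ?subr_ge0// distrC => h; apply: sub => //.
  exact/andP.
by rewrite ger0_norm ?subr_ge0 ?(ltW yx)// => h; apply: sub; rewrite ?y0 ?(ltW yx).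
Qed.

Lemma powR_weierstrass s (M e : R) : 0 <= s <= 1 -> 0 < M -> 0 < e ->
  exists p : {poly R}, forall x, 0 <= x <= M -> `|p.[x] - x `^ s| <= e.
Proof.
move=> s01 M0; apply: (@weierstrass (fun x => x `^ s) M (M `^ s)) => //.
  move=> x /andP[x0 xM]; rewrite ger0_norm ?powR_ge0//.
  case/andP: s01 => s0 _.
  by apply: ge0_ler_powR; rewrite ?nnegrE// (le_trans x0).
move=> e' /(powR_uniformly_continuous s01)[d d0 hd]; exists d => // x y.
by move=> /andP[x0 _] /andP[y0 _]; exact: hd.
Qed.

End Weierstrass.

(** * Continuous functional calculus *)

Section FunctionalCalculus.
Context {R : realType} {H : hilbertType R}.
Implicit Types (x y : H) (z a : R[i]) (T S X Y Z A : H -> H) (p q : {poly R[i]}).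
Implicit Types (f g h : R[i] -> R[i]) (e c s : R).

Lemma rnorm_small_eq0 (V : normedZmodType R[i]) (v : V) c :
  (forall e, 0 < e -> e <= 1 -> rnorm v <= c * e) -> v = 0.
Proof.
move=> hv; apply: rnorm0_eq0; apply/eqP; rewrite eq_le rnorm_ge0 andbT.
rewrite leNgt; apply/negP => v0.
have c0 : 0 < c by have := hv 1 ltr01 (lexx _); rewrite mulr1; exact: lt_le_trans.
pose e := Num.min 1 (rnorm v / (2 * c)).
have e0 : 0 < e by rewrite lt_min ltr01 divr_gt0// mulr_gt0.
have e1 : e <= 1 by rewrite ge_min lexx.
have := hv e e0 e1; apply/negP; rewrite -ltNge.
have : c * e <= c * (rnorm v / (2 * c)) by rewrite ler_wpM2l ?(ltW c0)// ge_min lexx orbT.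
have -> : c * (rnorm v / (2 * c)) = rnorm v / 2 by field; rewrite gt_eqF.
by lra.
Qed.

Lemma eq_op_of_small_sub X Y c :
  (forall e, 0 < e -> e <= 1 -> forall x, rnorm (X x - Y x) <= c * rnorm x * e) -> X =1 Y.
Proof.
move=> h x; apply/eqP; rewrite -subr_eq0; apply/eqP.
apply: (@rnorm_small_eq0 _ _ (c * rnorm x)) => e e0 e1; exact: h.
Qed.

Definition poly_approximable f T :=
  forall e, 0 < e -> exists p, forall z, spectrum T z -> rnorm (p.[z] - f z) <= e.

Lemma is_cfc_approximable f T X : is_cfc f T X -> poly_approximable f T.
Proof. by move=> [_ [p [hp _]]] e /hp[N _ hN]; exists (p N); apply: hN => /=. Qed.

(** An error of approximation on the spectrum is an error in norm. All properties
of [f(T)] below follow from the corresponding ones of polynomials through this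
estimate; in particular it does not matter which sequence of polynomials defines [X]. *)
Lemma opnorm_sub_cfc_le f T X p e : selfadjoint T -> is_cfc f T X -> 0 <= e ->
  (forall z, spectrum T z -> rnorm (p.[z] - f z) <= e) ->
  forall x, rnorm (poly_op p T x - X x) <= e * rnorm x.
Proof.
move=> sT [bX [q [qf qX]]] e0 pf x; have bT := sT.1.
apply/ler_addgt0Pr => d d0.
pose d' := d / (2 * (rnorm x + 1)).
have x1 : 0 < rnorm x + 1 by rewrite ltr_wpDl ?rnorm_ge0.
have d'0 : 0 < d' by rewrite divr_gt0// mulr_gt0.
have [N1 _ hN1] := qf _ d'0.
have [N2 _ hN2] := (cvgrPdist_le _ _).1 qX _ d'0.
pose n := maxn N1 N2.
have h1 := hN1 n (leq_maxl _ _); have := hN2 n (leq_maxr _ _).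
rewrite sub0r normrN ger0_norm ?opnorm_ge0// => h2.
have bq := bounded_poly_op (q n) bT.
have h3 : rnorm (poly_op (q n) T x - X x) <= d' * rnorm x.
  rewrite (le_trans (le_opnorm (bounded_sub bq bX) x))// ler_wpM2r ?rnorm_ge0//.
have h4 : rnorm (poly_op (p - q n) T x) <= (e + d') * rnorm x.
  rewrite (le_trans (le_opnorm (bounded_poly_op _ bT) x))// ler_wpM2r ?rnorm_ge0//.
  apply: opnorm_poly_op_le => //; first by rewrite addr_ge0// ltW.
  move=> z Tz; rewrite hornerD hornerN.
  rewrite (_ : _ - _ = (p.[z] - f z) - ((q n).[z] - f z)); last by ring.
  by rewrite (le_trans (rnormD _ _))// rnormN lerD// ?pf// h1.
rewrite (_ : poly_op p T x - X x =
  poly_op (p - q n) T x + (poly_op (q n) T x - X x)); last first.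
  by rewrite poly_opB addrA subrK.
rewrite (le_trans (rnormD _ _))// (le_trans (lerD h4 h3))//.
have h5 : d' * (2 * (rnorm x + 1)) = d by rewrite /d' divfK// gt_eqF// mulr_gt0.
by lra.
Qed.

(** Polynomials converging uniformly on the spectrum give a Cauchy sequence of
operators; its pointwise limit is also its limit in norm. *)
Lemma cfc_exists f T : selfadjoint T -> poly_approximable f T ->
  exists X, is_cfc f T X.
Proof.
move=> sT fT; have bT := sT.1.
have [d [d0 dsmall]] := @null_sequence_exists R.
have /choice[p hp] : forall n, exists p, forall z, spectrum T z -> rnorm (p.[z] - f z) <= d n.
  by move=> n; exact: fT.
have pcauchy m n x : rnorm (poly_op (p m) T x - poly_op (p n) T x) <= (d m + d n) * rnorm x.
  rewrite -poly_opB (le_trans (le_opnorm (bounded_poly_op _ bT) x))// ler_wpM2r ?rnorm_ge0//.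
  apply: opnorm_poly_op_le => //; first by rewrite addr_ge0// ltW.
  move=> z Tz; rewrite hornerD hornerN.
  rewrite (_ : _ - _ = ((p m).[z] - f z) - ((p n).[z] - f z)); last by ring.
  by rewrite (le_trans (rnormD _ _))// rnormN lerD// hp.
have /choice[X hX] : forall x, exists l, forall e, 0 < e ->
    exists N, forall n, (N <= n)%N -> rnorm (poly_op (p n) T x - l) <= e.
  move=> x; apply: cauchy_converges => e e0.
  have x1 : 0 < 2 * (rnorm x + 1) by rewrite mulr_gt0// ltr_wpDl ?rnorm_ge0.
  have [N hN] := dsmall _ (divr_gt0 e0 x1).
  exists N => m n Nm Nn; rewrite (le_trans (pcauchy _ _ _))//.
  rewrite (@le_trans _ _ ((e / (2 * (rnorm x + 1)) *+ 2) * (rnorm x + 1)))//.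
    by rewrite ler_pM ?addr_ge0 ?rnorm_ge0 ?(ltW (d0 _)) ?lerDl// mulr2n lerD ?hN.
  rewrite le_eqVlt; apply/orP; left; apply/eqP; field.
  by rewrite gt_eqF// ltr_wpDl ?rnorm_ge0.
have pX n x : rnorm (poly_op (p n) T x - X x) <= d n *+ 2 * rnorm x.
  apply/ler_addgt0Pr => e e0.
  have [N1 hN1] := hX x _ e0; have [N2 hN2] := dsmall _ (d0 n).
  have h1 := hN1 _ (leq_maxl N1 N2); have h2 := hN2 _ (leq_maxr N1 N2).
  move: h1 h2; set m := maxn _ _ => h1 h2.
  rewrite -(subrK (poly_op (p m) T x) (poly_op (p n) T x)) -addrA.
  rewrite (le_trans (rnormD _ _))// lerD// (le_trans (pcauchy _ _ _))//.
  by rewrite ler_wpM2r ?rnorm_ge0// mulr2n lerD.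
have bX : bounded_operator X.
  split.
    move=> a x y; apply/eqP; rewrite -subr_eq0; apply/eqP.
    apply: (@rnorm_small_eq0 _ _ (2 * (rnorm (a *: x + y) + rnorm a * rnorm x + rnorm y))).
    move=> e e0 _; have [N hN] := dsmall _ e0; have dN := hN _ (leqnn N).
    have bp := bounded_poly_op (p N) bT.
    have -> : X (a *: x + y) - (a *: X x + X y) =
      - (poly_op (p N) T (a *: x + y) - X (a *: x + y)) +
      (a *: (poly_op (p N) T x - X x) + (poly_op (p N) T y - X y)).
      by rewrite opprB (op_linear bp) scalerBr [X in _ = _ + X]addrACA -opprD addrA subrK.
    rewrite (le_trans (rnormD _ _))// rnormN.
    have h1 := pX N (a *: x + y); have h2 := pX N x; have h3 := pX N y.
    have h4 : rnorm (a *: (poly_op (p N) T x - X x)) <= rnorm a * (d N *+ 2 * rnorm x).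
      by rewrite rnormZ ler_wpM2l ?rnorm_ge0.
    have h5 := rnormD (a *: (poly_op (p N) T x - X x)) (poly_op (p N) T y - X y).
    apply: (@le_trans _ _ (2 * (rnorm (a *: x + y) + rnorm a * rnorm x + rnorm y) * d N)).
      by lra.
    by rewrite ler_wpM2l// mulr_ge0// !addr_ge0 ?mulr_ge0 ?rnorm_ge0.
  exists (d 0%N *+ 2 + opnorm (poly_op (p 0%N) T)) => x.
  rewrite -[X x](subrK (poly_op (p 0%N) T x)) (le_trans (rnormD _ _))// mulrDl.
  by rewrite lerD ?(le_opnorm (bounded_poly_op _ bT) x)// rnormBC.
exists X; split=> //; exists p; split.
  move=> e /dsmall[N hN]; exists N => // n /= Nn z Tz.
  by rewrite (le_trans (hp n z Tz))// hN.
apply/cvgrPdist_le => e e0.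
have [N hN] := dsmall _ (divr_gt0 e0 (ltr0Sn _ 1)).
exists N => // n /= Nn; rewrite sub0r normrN ger0_norm ?opnorm_ge0//.
apply: opnorm_bound; first exact: ltW.
move=> x; rewrite (le_trans (pX _ _))// ler_wpM2r ?rnorm_ge0//.
by have := hN n Nn; lra.
Qed.

Lemma cfcP f T : selfadjoint T -> poly_approximable f T -> is_cfc f T (cfc f T).
Proof. by move=> sT fT; exact: getPex (cfc_exists sT fT). Qed.

(** If [p] approximates a real function on the spectrum, which is real, so does the
polynomial with conjugate coefficients; the latter gives the adjoint of [p(T)]. *)
Lemma cfc_selfadjoint f T X : selfadjoint T -> is_cfc f T X ->
  (forall z, spectrum T z -> conjc (f z) = f z) -> selfadjoint X.
Proof.
move=> sT fX fR; have bT := sT.1; have bX := fX.1; split=> // x y.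
apply/eqP; rewrite -subr_eq0; apply/eqP.
apply: (@rnorm_small_eq0 _ _ (2 * (rnorm x * rnorm y))) => e e0 _.
have [p pf] := is_cfc_approximable fX e0.
have p'f z : spectrum T z -> rnorm ((map_poly conjc p).[z] - f z) <= e.
  move=> Tz; rewrite -rnormJ rmorphB/= fR// -{1}(conjcK z) horner_map/=.
  by rewrite conjcK {1}(spectrum_real sT Tz) conjc_real -(spectrum_real sT Tz) pf.
have h1 := opnorm_sub_cfc_le sT fX (ltW e0) pf x.
have h2 := opnorm_sub_cfc_le sT fX (ltW e0) p'f y.
have -> : inner (X x) y - inner x (X y) =
   - inner (poly_op p T x - X x) y + inner x (poly_op (map_poly conjc p) T y - X y).
  by rewrite innerBl innerBr poly_op_adjoint//; ring.
rewrite (le_trans (rnormD _ _))// rnormN.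
have h3 := cauchy_schwarz (poly_op p T x - X x) y.
have h4 := cauchy_schwarz x (poly_op (map_poly conjc p) T y - X y).
have h5 := ler_wpM2r (rnorm_ge0 y) h1; have h6 := ler_wpM2l (rnorm_ge0 x) h2.
by lra.
Qed.

Lemma cfc_mul f g h T X Y Z (F G : R) : selfadjoint T ->
  is_cfc f T X -> is_cfc g T Y -> is_cfc h T Z ->
  (forall z, spectrum T z -> rnorm (f z) <= F) ->
  (forall z, spectrum T z -> rnorm (g z) <= G) ->
  (forall z, spectrum T z -> h z = f z * g z) ->
  X \o Y =1 Z.
Proof.
move=> sT fX gY hZ fF gG hE; have bT := sT.1; have bX := fX.1; have bY := gY.1.
pose F' := `|F|; pose G' := `|G|.
have fF' z : spectrum T z -> rnorm (f z) <= F'.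
  by move=> Tz; rewrite (le_trans (fF z Tz))// ler_norm.
have gG' z : spectrum T z -> rnorm (g z) <= G'.
  by move=> Tz; rewrite (le_trans (gG z Tz))// ler_norm.
have F0 : 0 <= F' by exact: normr_ge0.
have G0 : 0 <= G' by exact: normr_ge0.
apply: (@eq_op_of_small_sub _ _ (opnorm Y + (F' + 1) + (F' + 1 + G'))) => e e0 e1 x /=.
have [p pf] := is_cfc_approximable fX e0; have [q qg] := is_cfc_approximable gY e0.
have pF z : spectrum T z -> rnorm p.[z] <= F' + 1.
  move=> Tz; rewrite -(subrK (f z) p.[z]) (le_trans (rnormD _ _))// addrC lerD ?fF'//.
  by rewrite (le_trans (pf z Tz)).
have h1 := opnorm_sub_cfc_le sT fX (ltW e0) pf (Y x).
have h2 := opnorm_sub_cfc_le sT gY (ltW e0) qg x.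
have c0 : 0 <= (F' + 1 + G') * e by rewrite mulr_ge0 ?addr_ge0// ltW.
have pqh z : spectrum T z -> rnorm ((p * q).[z] - h z) <= (F' + 1 + G') * e.
  move=> Tz; rewrite hornerM hE//.
  have -> : p.[z] * q.[z] - f z * g z = p.[z] * (q.[z] - g z) + (p.[z] - f z) * g z by ring.
  rewrite (le_trans (rnormD _ _))// !rnormM mulrDl lerD//.
    by rewrite ler_pM ?rnorm_ge0 ?pF ?qg.
  by rewrite [leRHS]mulrC ler_pM ?rnorm_ge0 ?gG' ?pf.
have h3 := opnorm_sub_cfc_le sT hZ c0 pqh x.
have h4 : rnorm (poly_op p T (poly_op q T x - Y x)) <= (F' + 1) * (e * rnorm x).
  rewrite (le_trans (le_opnorm (bounded_poly_op _ bT) _))//.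
  rewrite ler_pM ?opnorm_ge0 ?rnorm_ge0//.
  by apply: opnorm_poly_op_le => //; rewrite addr_ge0.
have h5 := ler_wpM2l (ltW e0) (le_opnorm bY x).
have -> : X (Y x) - Z x = - (poly_op p T (Y x) - X (Y x)) +
   (- poly_op p T (poly_op q T x - Y x) + (poly_op (p * q) T x - Z x)).
  rewrite (opB (bounded_poly_op p bT)) (poly_opM _ _ _ bT) !opprB addrA.
  rewrite [X (Y x) - _ + _]addrA subrK.
  by rewrite addrA subrK.
rewrite (le_trans (rnormD _ _))// rnormN.
have := rnormD (- poly_op p T (poly_op q T x - Y x)) (poly_op (p * q) T x - Z x).
rewrite rnormN; lra.
Qed.

End FunctionalCalculus.

(** * Real powers of a positive operator *)

Section Powers.
Context {R : realType} {H : hilbertType R}.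
Implicit Types (x y : H) (z : R[i]) (T S X A : H -> H) (e s r : R).

Let powf s z : R[i] := (Re z `^ s)%:C.

(** One polynomial serves all positive operators of norm at most [M]; intertwining
two different operators depends on this uniformity. *)
Lemma powf_approximation s (M e : R) : 0 <= s <= 1 -> 0 < M -> 0 < e ->
  exists p, forall S, positive_op S -> opnorm S <= M ->
    forall z, spectrum S z -> rnorm (p.[z] - powf s z) <= e.
Proof.
move=> s01 M0 e0; have [p hp] := powR_weierstrass s01 M0 e0.
exists (map_poly (real_complex R) p) => S pS SM z Sz.
have /andP[z0 z1] := spectrum_positive pS Sz.
rewrite [in X in _.[X]](spectrum_real pS.1 Sz) horner_map/= -rmorphB/= rnorm_real hp//.
by rewrite z0 (le_trans z1).
Qed.

Lemma opowP T s : positive_op T -> 0 <= s <= 1 -> is_cfc (powf s) T (opow T s).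
Proof.
move=> pT s01; apply: cfcP; first exact: pT.1.
move=> e e0; have M0 : 0 < opnorm T + 1 by rewrite ltr_wpDl ?opnorm_ge0.
have [p hp] := powf_approximation s01 M0 e0.
by exists p; apply: hp => //; rewrite lerDl.
Qed.

Lemma opow_selfadjoint T s : positive_op T -> 0 <= s <= 1 -> selfadjoint (opow T s).
Proof.
move=> pT s01; apply: cfc_selfadjoint (opowP pT s01) _; first exact: pT.1.
by move=> z _; rewrite conjc_real.
Qed.

Lemma opow1 T : positive_op T -> opow T 1 =1 T.
Proof.
move=> pT x; have s01 : 0 <= (1 : R) <= 1 by rewrite ler01 lexx.
have : rnorm (poly_op 'X T x - opow T 1 x) <= 0 * rnorm x.
  apply: (opnorm_sub_cfc_le pT.1 (opowP pT s01)) => // z Tz.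
  have /andP[z0 _] := spectrum_positive pT Tz.
  by rewrite hornerX /powf powRr1// -(spectrum_real pT.1 Tz) subrr rnorm0.
rewrite mul0r poly_opX => h; apply/eqP; rewrite eq_sym -subr_eq0; apply/eqP/rnorm0_eq0.
by apply/eqP; rewrite eq_le h rnorm_ge0.
Qed.

(** The exponents are nonnegative, so the rule of exponents holds at the point 0 of
the spectrum too, with [0 `^ 0 = 1]. *)
Lemma opowD T s r : positive_op T -> 0 <= s -> 0 <= r -> s + r <= 1 ->
  opow T s \o opow T r =1 opow T (s + r).
Proof.
move=> pT s0 r0 sr1.
have bound q z : 0 <= q -> spectrum T z -> rnorm (powf q z) <= opnorm T `^ q.
  move=> q0 Tz; have /andP[z0 z1] := spectrum_positive pT Tz.
  rewrite /powf rnorm_real ger0_norm ?powR_ge0//.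
  by apply: ge0_ler_powR; rewrite ?nnegrE ?opnorm_ge0.
have s1 : s <= 1 by lra.
have r1 : r <= 1 by lra.
apply: (@cfc_mul _ _ (powf s) (powf r) (powf (s + r)) T _ _ _
  (opnorm T `^ s) (opnorm T `^ r)).
- exact: pT.1.
- by apply: opowP => //; rewrite s0.
- by apply: opowP => //; rewrite r0.
- by apply: opowP => //; rewrite addr_ge0.
- by move=> z; exact: bound.
- by move=> z; exact: bound.
move=> z Tz; rewrite /powf -rmorphM/=; congr (_%:C).
have [->|s_neq0] := eqVneq s 0; first by rewrite add0r powRr0 mul1r.
have [->|z_neq0] := eqVneq (Re z) 0.
  by rewrite (powR0 s_neq0) mul0r powR0// gt_eqF// ltr_pwDl// lt_def s_neq0.
by rewrite powRD// z_neq0 implybT.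
Qed.

(** A power is the square of the self-adjoint power of half the exponent. *)
Lemma opow_positive T s : positive_op T -> 0 <= s <= 1 -> positive_op (opow T s).
Proof.
move=> pT s01; split; first exact: opow_selfadjoint.
move=> x; case/andP: (s01) => s0 s1.
have h0 : 0 <= s / 2 by lra.
have h1 : s / 2 + s / 2 <= 1 by lra.
have := opowD pT h0 h0 h1 x; rewrite -splitr => <- /=.
rewrite (opow_selfadjoint pT _).2; last by lra.
by rewrite innerxx/= sqr_ge0.
Qed.

Lemma opow_intertwine A T S s : bounded_operator A -> positive_op T -> positive_op S ->
  0 <= s <= 1 -> (forall x, A (T x) = S (A x)) ->
  forall x, A (opow T s x) = opow S s (A x).
Proof.
move=> bA pT pS s01 AT.
pose M := opnorm T + opnorm S + 1.
have M0 : 0 < M by rewrite ltr_wpDl ?addr_ge0 ?opnorm_ge0.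
apply: (@eq_op_of_small_sub _ _ (A \o opow T s) (opow S s \o A) (opnorm A + opnorm A)).
move=> e e0 _ x /=.
have [p hp] := powf_approximation s01 M0 e0.
have TM : opnorm T <= M by have := opnorm_ge0 S; rewrite /M; lra.
have SM : opnorm S <= M by have := opnorm_ge0 T; rewrite /M; lra.
have h1 := opnorm_sub_cfc_le pT.1 (opowP pT s01) (ltW e0) (hp _ pT TM) x.
have h2 := opnorm_sub_cfc_le pS.1 (opowP pS s01) (ltW e0) (hp _ pS SM) (A x).
have -> : A (opow T s x) - opow S s (A x) =
  - A (poly_op p T x - opow T s x) + (poly_op p S (A x) - opow S s (A x)).
  by rewrite (opB bA) (poly_op_intertwine _ _ bA AT) opprB addrA subrK.
rewrite (le_trans (rnormD _ _))// rnormN.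
have h3 := le_opnorm bA (poly_op p T x - opow T s x).
have h4 := ler_wpM2l (opnorm_ge0 A) h1.
have h5 := ler_wpM2l (ltW e0) (le_opnorm bA x).
lra.
Qed.

End Powers.

(** * Absolute values and the mixed Schwarz inequality *)

Section AbsoluteValue.
Context {R : realType} {H : hilbertType R}.
Implicit Types (x y : H) (T S A F G : H -> H) (e s t : R).

Lemma adjoint_comp_positive A : bounded_operator A -> positive_op (adjoint A \o A).
Proof.
move=> bA; have bA' := bounded_adjoint bA; split.
  split; first exact: bounded_comp.
  by move=> x y /=; rewrite inner_adjointl// inner_adjointr.
by move=> x /=; rewrite inner_adjointl// innerxx/= sqr_ge0.
Qed.

Let half01 : 0 <= (2^-1 : R) <= 1. Proof. by apply/andP; split; lra. Qed.

Lemma oabs_positive A : bounded_operator A -> positive_op (oabs A).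
Proof. by move=> bA; apply: opow_positive half01; exact: adjoint_comp_positive. Qed.

Lemma oabs_sqr A x : bounded_operator A -> oabs A (oabs A x) = adjoint A (A x).
Proof.
move=> bA; have pA := adjoint_comp_positive bA.
have h : 0 <= 2^-1 :> R by lra.
rewrite /oabs [LHS](opowD pA h h); last by lra.
rewrite (_ : 2^-1 + 2^-1 = 1 :> R); last by lra.
exact: opow1.
Qed.

Lemma opow_half T x : positive_op T -> opow T 2^-1 (opow T 2^-1 x) = T x.
Proof.
move=> pT; have h : 0 <= 2^-1 :> R by lra.
rewrite [LHS](opowD pT h h); last by lra.
rewrite (_ : 2^-1 + 2^-1 = 1 :> R); last by lra.
exact: opow1.
Qed.

Lemma rnorm_oabs A x : bounded_operator A -> rnorm (oabs A x) = rnorm (A x).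
Proof.
move=> bA; apply/eqP; rewrite -(eqrXn2 (n := 2)) ?rnorm_ge0//; apply/eqP.
apply: complexI; rewrite -!innerxx (oabs_positive bA).1.2 oabs_sqr//.
by rewrite inner_adjointr.
Qed.

(** [A] intertwines [A^* A] with [A A^*], hence also their square roots. *)
Lemma oabs_intertwine A x : bounded_operator A ->
  A (oabs A x) = oabs (adjoint A) (A x).
Proof.
move=> bA; have bA' := bounded_adjoint bA.
apply: opow_intertwine half01 _ _ => //; try exact: adjoint_comp_positive.
by move=> y /=; rewrite adjointK.
Qed.

(** Write [P = |A|], [Q = |A^*|]. For [x = P z] the claim is the Cauchy-Schwarz
inequality for the form of [Q], since [A P z = Q A z] and
[<Q A z, A z> = <P^3 z, z> = <P x, x>]. A general [x] equals [P z + e z] for some [z],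
because [P + e] is coercive; the resulting error [e <A z, y>] is at most
[e |x| |y|] because [|A z| = |P z| <= |x|]. *)
Lemma mixed_schwarz A x y : bounded_operator A ->
  rnorm (inner (A x) y) <=
  rnorm (opow (oabs A) 2^-1 x) * rnorm (opow (oabs (adjoint A)) 2^-1 y).
Proof.
move=> bA; have bA' := bounded_adjoint bA.
set P := oabs A; set Q := oabs (adjoint A).
have pP : positive_op P by exact: oabs_positive.
have pQ : positive_op Q by exact: oabs_positive.
have bP := pP.1.1.
have AP w : A (P w) = Q (A w) by exact: oabs_intertwine.
have PP w : P (P w) = adjoint A (A w) by exact: oabs_sqr.
have normP w : rnorm (P w) = rnorm (A w) by exact: rnorm_oabs.
set a := opow P _; set b := opow Q _.
have sa : selfadjoint a by exact: opow_selfadjoint.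
have sb : selfadjoint b by exact: opow_selfadjoint.
have aa w : a (a w) = P w by exact: opow_half.
have bb w : b (b w) = Q w by exact: opow_half.
clearbody a b P Q.
have asq w : rnorm (a w) ^+ 2 = Re (inner (P w) w) by rewrite -aa sa.2 innerxx.
have bsq w : rnorm (b w) ^+ 2 = Re (inner (Q w) w) by rewrite -bb sb.2 innerxx.
have PE z w : inner (P z) w = inner z (P w) by exact: pP.1.2.
rewrite -[leRHS]addr0; apply/ler_addgt0Pr => d d0; rewrite addr0.
pose C := rnorm x * rnorm y + 1.
have C0 : 0 < C by rewrite ltr_wpDl// mulr_ge0 ?rnorm_ge0.
pose e := d / C; have e0 : 0 < e by rewrite divr_gt0.
have [z xE] : exists z, P z + e%:C *: z = x.
  have [|||S [_ hS _]] := @coercive_invertible _ _ (fun z => P z + e%:C *: z) e.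
  - exact: bounded_add bP (bounded_scale _ bounded_id).
  - by [].
  - move=> z; apply: le_trans (ler_Re_rnorm _).
    by rewrite innerDl innerZl innerxx -rmorphM raddfD/= lerDr; exact: pP.2.
  - by exists (S x).
have hz : rnorm (A z) <= rnorm x.
  rewrite -normP -ler_sqr ?nnegrE ?rnorm_ge0// -xE rnormD_sqr.
  rewrite innerZr conjc_real -addrA lerDl addr_ge0 ?sqr_ge0//.
  rewrite mulr_ge0//; have := pP.2 z.
  by case: (inner _ _) => u v /= u0; rewrite mul0r subr0 mulr_ge0// ltW.
have hb : rnorm (b (A z)) <= rnorm (a x).
  rewrite -ler_sqr ?nnegrE ?rnorm_ge0// bsq asq.
  have -> : inner (Q (A z)) (A z) = inner (P (P z)) (P z).
    by rewrite -AP -inner_adjointr// -PP [RHS]PE.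
  rewrite -xE (opD bP) (opZ bP) innerDl !innerDr !innerZl !innerZr conjc_real.
  rewrite (PE (P z) z) innerxx.
  have := pP.2 z; case: (inner (P z) z) => u v /= u0.
  case: (inner (P (P z)) (P z)) => u' v' /=.
  rewrite !(mul0r, mulr0, subr0, addr0, add0r).
  have := sqr_ge0 (rnorm (P z)); set q := _ ^+ 2 => q0.
  have h1 : 0 <= e * q by rewrite mulr_ge0// ltW.
  have h2 : 0 <= e * (e * u) := mulr_ge0 (ltW e0) (mulr_ge0 (ltW e0) u0).
  by lra.
have -> : inner (A x) y = inner (b (A z)) (b y) + e%:C * inner (A z) y.
  rewrite -{1}xE (opD bA) (opZ bA) innerDl innerZl AP.
  by rewrite -bb sb.2.
rewrite (le_trans (rnormD _ _))// rnormM rnorm_real (ger0_norm (ltW e0)) lerD//.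
  rewrite (le_trans (cauchy_schwarz _ _))// ler_wpM2r ?rnorm_ge0//.
have h1 := cauchy_schwarz (A z) y.
have h2 : rnorm (inner (A z) y) <= C.
  rewrite /C (le_trans h1)// (le_trans (ler_wpM2r (rnorm_ge0 y) hz))//.
  by rewrite lerDl.
by rewrite (le_trans (ler_wpM2l (ltW e0) h2))// /e divfK// gt_eqF.
Qed.

End AbsoluteValue.

(** * Growth of iterates *)

Section Growth.
Context {R : realType} {H : hilbertType R}.
Implicit Types (x : H) (T F G : H -> H).

Lemma iter_comp_swap F G n x :
  iter n.+1 (F \o G) x = F (iter n (G \o F) (G x)).
Proof. by elim: n => //= n IH; rewrite IH. Qed.

Lemma opnorm_iter_le T n x : bounded_operator T ->
  rnorm (iter n T x) <= opnorm T ^+ n * rnorm x.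
Proof.
move=> bT; elim: n => [|n IH]; first by rewrite expr0 mul1r.
rewrite iterS (le_trans (le_opnorm bT _))// exprS -mulrA ler_wpM2l ?opnorm_ge0//.
Qed.

(** The norms of the iterates of [x] form a logarithmically convex sequence, as
[|T^k.+1 x|^2 = <T^k x, T^k.+2 x>]; it therefore grows at least at its initial rate. *)
Lemma selfadjoint_iter_logconvex T n x : selfadjoint T -> rnorm x = 1 ->
  rnorm (T x) ^+ n <= rnorm (iter n T x).
Proof.
move=> sT x1.
have step k : rnorm (T x) * rnorm (iter k T x) <= rnorm (iter k.+1 T x).
  elim: k => [|k IH]; first by rewrite /= x1 mulr1.
  have [k0|k0] := eqVneq (iter k T x) 0.
    by rewrite iterS k0 (op0 sT.1) rnorm0 mulr0 rnorm_ge0.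
  have kp : 0 < rnorm (iter k T x).
    by rewrite lt_def rnorm_ge0 andbT; apply: contra_neq k0; exact: rnorm0_eq0.
  rewrite -(ler_pM2l kp).
  have h : rnorm (iter k.+1 T x) ^+ 2 <= rnorm (iter k T x) * rnorm (iter k.+2 T x).
    have -> : rnorm (iter k.+1 T x) ^+ 2 = Re (inner (iter k T x) (iter k.+2 T x)).
      by rewrite (iterS k.+1) -sT.2 -iterS innerxx.
    by rewrite (le_trans (ler_Re_rnorm _))// cauchy_schwarz.
  apply: le_trans h; rewrite mulrA [_ * rnorm (T x)]mulrC expr2.
  by rewrite ler_wpM2r ?rnorm_ge0.
elim: n => [|n IH]; first by rewrite expr0 /= x1.
rewrite exprS (le_trans _ (step n))// ler_wpM2l ?rnorm_ge0//.
Qed.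

(** A quotient [d / k > 1] would have unbounded powers, by Bernoulli's inequality. *)
Lemma ler_of_geometric (d k C : R) : 0 <= d -> 0 <= k ->
  (forall n, d ^+ n.+1 <= C * k ^+ n) -> d <= k.
Proof.
move=> d0 k0 h; rewrite leNgt; apply/negP => kd.
have dp : 0 < d by exact: le_lt_trans kd.
have [k00|kn0] := eqVneq k 0.
  by have := h 1%N; rewrite k00 expr1 mulr0 leNgt exprn_gt0.
have kp : 0 < k by rewrite lt_def kn0.
pose u := d / k - 1.
have u0 : 0 < u by rewrite subr_gt0 ltr_pdivlMr// mul1r.
have bernoulli n : 1 + n%:R * u <= (d / k) ^+ n.
  elim: n => [|n IH]; first by rewrite mul0r addr0 expr0.
  have dE : d / k = 1 + u by rewrite /u addrC subrK.
  rewrite exprS (le_trans _ (ler_wpM2l _ IH)) ?divr_ge0// dE.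
  have : 0 <= n%:R * (u * u) by rewrite !mulr_ge0// ltW.
  by rewrite -natr1; lra.
have hC n : d * (1 + n%:R * u) <= C.
  rewrite (le_trans (ler_wpM2l d0 (bernoulli n)))// expr_div_n mulrA -exprS.
  by rewrite ler_pdivrMr ?exprn_gt0.
have du : 0 < d * u by rewrite mulr_gt0.
pose n := Num.truncn (C / (d * u)).
have := hC n.+1; have := truncnS_gt (C / (d * u)); rewrite ltr_pdivrMr// -/n.
by lra.
Qed.

(** [F G] and [G F] have the same spectral radius, and that of a self-adjoint
operator is its norm. Concretely, [(F G)^n.+1 = F (G F)^n G] bounds the growth of
[|(F G)^n x|] by the powers of the norm of [G F], whereas the self-adjoint [F G]
grows at least at the rate [|F G x|]. *)
Lemma opnorm_comp_swap F G : bounded_operator F -> bounded_operator G ->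
  selfadjoint (F \o G) -> opnorm (F \o G) <= opnorm (G \o F).
Proof.
move=> bF bG sFG; apply: opnorm_le; first exact: opnorm_ge0.
move=> x x1; have bGF := bounded_comp bG bF.
apply: (@ler_of_geometric _ _ (opnorm F * rnorm (G x))).
- exact: rnorm_ge0.
- exact: opnorm_ge0.
move=> n; rewrite (le_trans (selfadjoint_iter_logconvex n.+1 sFG x1))//.
rewrite iter_comp_swap (le_trans (le_opnorm bF _))// -mulrA ler_wpM2l ?opnorm_ge0//.
by rewrite mulrC opnorm_iter_le.
Qed.

End Growth.

(** * Norm estimates and the numerical radius *)

Section NormBounds.
Context {R : realType} {H : hilbertType R}.
Implicit Types (x y : H) (T S A P Q a b : H -> H) (t N : R).

Lemma numerical_radius_le T (c : R) : 0 <= c ->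
  (forall x, rnorm x = 1 -> rnorm (inner (T x) x) <= c) -> numerical_radius T <= c.
Proof.
move=> c0 h; rewrite /numerical_radius; set E := (X in sup X).
have [->|/set0P n0] := eqVneq E set0; first by rewrite sup0.
by apply: ge_sup => // _ [x x1 <-]; exact: h.
Qed.

(** Put [a = P^(1/2)], [b = Q^(1/2)], [F = b P^t] and [G = P^(1 - t) b]. Then
[F G = b P b = (a b)^* (a b)] is self-adjoint, while
[G F = P^(1 - t) Q P^t = (P^(1 - t) Q^(1 - t)) (Q^t P^t)]. *)
Lemma opnorm_half_power_comp_le P Q t : positive_op P -> positive_op Q -> 0 <= t <= 1 ->
  opnorm (opow P 2^-1 \o opow Q 2^-1) <=
  Num.sqrt (opnorm (opow P t \o opow Q t) * opnorm (opow P (1 - t) \o opow Q (1 - t))).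
Proof.
move=> pP pQ t01; case/andP: (t01) => t0 t1.
have u0 : 0 <= 1 - t by lra.
have u01 : 0 <= 1 - t <= 1 by apply/andP; split; lra.
have h01 : 0 <= (2^-1 : R) <= 1 by apply/andP; split; lra.
have sPt := opow_selfadjoint pP t01; have sQt := opow_selfadjoint pQ t01.
have sPu := opow_selfadjoint pP u01; have sQu := opow_selfadjoint pQ u01.
have sa := opow_selfadjoint pP h01; have sb := opow_selfadjoint pQ h01.
have aa x := opow_half x pP; have bb x := opow_half x pQ.
have Ptu x : opow P t (opow P (1 - t) x) = P x.
  rewrite [LHS](opowD pP t0 u0); last by lra.
  by rewrite addrC subrK opow1.
have Qut x : opow Q (1 - t) (opow Q t x) = Q x.
  by rewrite [LHS](opowD pQ u0 t0); rewrite subrK// opow1.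
move: sPt sQt sPu sQu sa sb aa bb Ptu Qut.
move: (opow P t) (opow P (1 - t)) (opow Q t) (opow Q (1 - t)) (opow P 2^-1) (opow Q 2^-1).
move=> Pt Pu Qt Qu a b sPt sQt sPu sQu sa sb aa bb Ptu Qut.
set K := _ * _; have K0 : 0 <= K by rewrite mulr_ge0 ?opnorm_ge0.
have bF := bounded_comp sb.1 sPt.1; have bG := bounded_comp sPu.1 sb.1.
have FGE x : ((b \o Pt) \o (Pu \o b)) x = b (P (b x)) by rewrite /= Ptu.
have sFG : selfadjoint ((b \o Pt) \o (Pu \o b)).
  split; first exact: bounded_comp bF bG.
  by move=> x y; rewrite !FGE sb.2 pP.1.2 sb.2.
have GFK : opnorm ((Pu \o b) \o (b \o Pt)) <= K.
  have -> : (Pu \o b) \o (b \o Pt) = (Pu \o Qu) \o (Qt \o Pt).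
    by apply/funext => x /=; rewrite bb Qut.
  rewrite (le_trans (opnorm_comp (bounded_comp sPu.1 sQu.1) (bounded_comp sQt.1 sPt.1)))//.
  rewrite /K mulrC ler_wpM2r ?opnorm_ge0//.
  apply: opnorm_adjoint_pair; [exact: bounded_comp sPt.1 sQt.1|exact: bounded_comp sQt.1 sPt.1|].
  by move=> x y /=; rewrite sPt.2 sQt.2.
have FGK := le_trans (opnorm_comp_swap bF bG sFG) GFK.
apply: opnorm_le; first exact: sqrtr_ge0.
move=> x x1; rewrite -[leLHS]ger0_norm ?rnorm_ge0// -sqrtr_sqr ler_wsqrtr//.
have -> : rnorm ((a \o b) x) ^+ 2 = Re (inner (((b \o Pt) \o (Pu \o b)) x) x).
  by rewrite FGE sb.2 -aa sa.2 innerxx.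
rewrite (le_trans (ler_Re_rnorm _))// (le_trans (cauchy_schwarz _ _))// x1 mulr1.
by rewrite (le_trans (le_opnorm sFG.1 x))// x1 mulr1.
Qed.

(** The sum [S] of squares is [<a u + b v, x>] with [u = a x], [v = b x], and so at most
the norm of [a u + b v]. Expanding the square of the latter gives
[S ^+ 2 <= (N + opnorm (a \o b)) * S]. This is the bound for the norm of the positive
operator matrix with diagonal [P], [Q] and off-diagonal entry [a b]. *)
Lemma sum_of_squares_le a b P Q N x : selfadjoint a -> selfadjoint b ->
  (forall x, a (a x) = P x) -> (forall x, b (b x) = Q x) ->
  (forall x, rnorm (P x) <= N * rnorm x) -> (forall x, rnorm (Q x) <= N * rnorm x) ->
  rnorm x = 1 -> rnorm (a x) ^+ 2 + rnorm (b x) ^+ 2 <= N + opnorm (a \o b).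
Proof.
move=> sa sb aa bb PN QN x1; set m := opnorm _.
have m0 : 0 <= m by exact: opnorm_ge0.
pose u := a x; pose v := b x; pose S := rnorm u ^+ 2 + rnorm v ^+ 2.
have S0 : 0 <= S by rewrite addr_ge0 ?sqr_ge0.
have h1 : S <= rnorm (a u + b v).
  have -> : S = Re (inner (a u + b v) x).
    by rewrite innerDl sa.2 sb.2 raddfD/= -/u -/v !innerxx.
  by rewrite (le_trans (ler_Re_rnorm _))// (le_trans (cauchy_schwarz _ _))// x1 mulr1.
have hN T c y : selfadjoint T -> (forall y, T (T y) = c y) ->
    (forall y, rnorm (c y) <= N * rnorm y) -> rnorm (T y) ^+ 2 <= N * rnorm y ^+ 2.
  move=> sT TT cN; have -> : rnorm (T y) ^+ 2 = Re (inner (c y) y).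
    by rewrite -TT sT.2 innerxx.
  rewrite (le_trans (ler_Re_rnorm _))// (le_trans (cauchy_schwarz _ _))//.
  by rewrite expr2 mulrA ler_wpM2r ?rnorm_ge0.
have h2 := hN a P u sa aa PN; have h3 := hN b Q v sb bb QN.
have h4 : Re (inner (a u) (b v)) <= m * (rnorm u * rnorm v).
  rewrite sa.2 (le_trans (ler_Re_rnorm _))// (le_trans (cauchy_schwarz _ _))//.
  rewrite mulrCA ler_wpM2l ?rnorm_ge0//.
  exact: (le_opnorm (bounded_comp sa.1 sb.1) v).
have h5 : 0 <= m * (rnorm u - rnorm v) ^+ 2 by rewrite mulr_ge0 ?sqr_ge0.
have h6 : rnorm (a u + b v) ^+ 2 <= (N + m) * S by rewrite rnormD_sqr /S; lra.
have h7 : S ^+ 2 <= (N + m) * S.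
  by rewrite (le_trans _ h6)// ler_sqr ?nnegrE ?rnorm_ge0.
have [S00|Sn0] := eqVneq S 0.
  rewrite -/u -/v -/S S00 addr_ge0//.
  by have := PN x; rewrite x1 mulr1; apply: le_trans; exact: rnorm_ge0.
by rewrite -/u -/v -/S -(ler_pM2r (_ : 0 < S)) -?expr2// lt_def Sn0.
Qed.

End NormBounds.

Lemma ler_half_of_product (R : realType) (w n m k a b : R) :
  w <= a * b -> a ^+ 2 + b ^+ 2 <= n + m -> m <= k -> w <= 2^-1 * (n + k).
Proof. by have := sqr_ge0 (a - b); lra. Qed.

Theorem theorem2p4 (R : realType) (H : hilbertType R) (A : H -> H) (t : R)
  (hA : bounded_operator A) (ht : 0 <= t <= 1) :
  numerical_radius A <=
  2^-1 * (opnorm A +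
    Num.sqrt (opnorm (opow (oabs A) t \o opow (oabs (adjoint A)) t) *
              opnorm (opow (oabs A) (1 - t) \o opow (oabs (adjoint A)) (1 - t)))).
Proof.
have hA' := bounded_adjoint hA.
have pP := oabs_positive hA; have pQ := oabs_positive hA'.
have h01 : 0 <= (2^-1 : R) <= 1 by apply/andP; split; lra.
have K := opnorm_half_power_comp_le pP pQ ht.
have sa := opow_selfadjoint pP h01; have sb := opow_selfadjoint pQ h01.
have aa y := opow_half y pP; have bb y := opow_half y pQ.
have PA y : rnorm (oabs A y) <= opnorm A * rnorm y by rewrite rnorm_oabs// le_opnorm.
have QA y : rnorm (oabs (adjoint A) y) <= opnorm A * rnorm y.
  rewrite rnorm_oabs// (le_trans (le_opnorm hA' y))// ler_wpM2r ?rnorm_ge0//.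
  by apply: opnorm_adjoint_pair => //; exact: (adjointP hA).2.
apply: numerical_radius_le.
  by rewrite mulr_ge0 ?invr_ge0// addr_ge0 ?opnorm_ge0 ?sqrtr_ge0.
move=> x x1; have hS := mixed_schwarz x x hA.
have hsum := sum_of_squares_le sa sb aa bb PA QA x1.
exact: ler_half_of_product hS hsum K.
Qed.
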